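(* Let $\lambda\in\mathbb R$, $t_0\in[0,1]$ be such that $(\lambda,t_0)$ is a conjugate point, i.e. $\ker(H_{t_0}-\lambda)\ne\{0\}$, and assume: (i) $\lambda\notin\mathrm{Spec}_{ess}(H_{t_0})$; and there exists an interval $\mathcal J\subset[0,1]$ centered at $t_0$ such that (ii) the mappings $t\mapsto\mathrm T_t$, $t\mapsto V_t$, $t\mapsto Q_t$ are $C^1$ on $\mathcal J$; (iii) $\ker(A^*+V_t-\lambda)\cap\mathrm{dom}(A)=\{0\}$ for all $t\in\mathcal J$. Let $m=\dim\ker(H_{t_0}-\lambda)$, and let $\{u_j\}_{j=1}^m$ be an orthonormal basis of $\ker(H_{t_0}-\lambda)$ and $\{\lambda_j(t)\}_{j=1}^m$ (with $\lambda_j(t_0)=\lambda$) a labeling of the eigenvalues of $H_t$ bifurcating from $\lambda$, for $t$ near $t_0$, as provided by the Hadamard-type formula for ordinary boundary triplets, that is, such that $$\dot\lambda_j(t_0)=\langle\dot V_{t_0}u_j,u_j\rangle_{\mathcal H}+\omega(\dot Q_{t_0}\mathrm T_{t_0}u_j,\mathrm T_{t_0}u_j)+\omega(\mathrm T_{t_0}u_j,\dot{\mathrm T}_{t_0}u_j),\quad1\le j\le m.$$ Let $\mathbf q_j:=(\mathrm T_{t_0}u_j,\mathrm T_{t_0}u_j)^\top\in\Upsilon_{\lambda,t_0}\cap\mathfrak D$. Then $$\dot\lambda_j(t_0)=\mathfrak m_{t_0}(\mathbf q_j,\mathbf q_j),\quad1\le j\le m,$$ where $\mathfrak m_{t_0}$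 is the Maslov crossing form of $t\mapsto\Upsilon_{\lambda,t}$ relative to $\mathfrak D$ at $(\lambda,t_0)$.
   Context: Inner products are linear in the first argument. $\mathcal H,\mathfrak H$ are complex separable Hilbert spaces; $A$ is a densely defined, closed, symmetric operator in $\mathcal H$ with equal deficiency indices; $\mathcal H_+:=\mathrm{dom}(A^* )$ carries the graph inner product. For each $t\in[0,1]$: $\mathrm T_t=[\Gamma_{0t},\Gamma_{1t}]^\top\in\mathcal B(\mathcal H_+,\mathfrak H\times\mathfrak H)$ is such that $(\mathfrak H,\Gamma_{0t},\Gamma_{1t})$ is an ordinary boundary triplet ($\mathrm T_t$ is surjective and $\langle A^*u,v\rangle_{\mathcal H}-\langle u,A^*v\rangle_{\mathcal H}=\langle\Gamma_{1t}u,\Gamma_{0t}v\rangle_{\mathfrak H}-\langle\Gamma_{0t}u,\Gamma_{1t}v\rangle_{\mathfrak H}$ for $u,v\in\mathcal H_+$); $Q_t$ is an orthogonal projection in $\mathfrak H\times\mathfrak H$ with Lagrangian range; $\mathcal A_t$ is a self-adjoint extension of $A$ with $\mathrm T_t(\mathrm{dom}(\mathcal A_t))=\mathrm{ran}(Q_t)$; $V_t\in\mathcal B(\mathcal H)$ is self-adjoint; $H_t=\mathcal A_t+V_t$. $J=\begin{bmatrix}0&I_{\mathfrak H}\\-I_{\mathfrak H}&0\end{bmatrix}$, $\omega(f,g)=\langle Jf,g\rangle_{\mathfrak H\times\mathfrak H}$; a subspace $\mathcal F\subset\mathfrak H\times\mathfrak H$ is Lagrangian if it equals $\{f:\omega(f,g)=0\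 \forall g\in\mathcal F\}$. The dot is the $t$-derivative; $C^1$ is with respect to operator norms. $\mathrm{Spec}_{ess}$ is the complement in the spectrum of the isolated eigenvalues of finite multiplicity. The eigenvalues bifurcating from $\lambda$ are the $m$ eigenvalues (with multiplicity) of $H_t$, $t$ near $t_0$, in a small disc around $\lambda$ containing no other point of $\mathrm{Spec}(H_{t_0})$. Set $\mathbb K_{\lambda,t}:=\mathrm T_t(\ker(A^*+V_t-\lambda))$, $\mathcal F_t:=\mathrm{ran}(Q_t)$, $\Upsilon_{\lambda,t}:=\mathbb K_{\lambda,t}\oplus\mathcal F_t\subset(\mathfrak H\times\mathfrak H)\oplus(\mathfrak H\times\mathfrak H)$, $\mathfrak D:=\{(p,p)^\top:p\in\mathfrak H\times\mathfrak H\}$, $\widehat\omega:=\omega\oplus(-\omega)$. Under (i)-(iii) there are an interval $\mathcal I\subset\mathcal J$ centered at $t_0$ and a $C^1$ family $t\mapsto\mathcal M_{\lambda,t}\in\mathcal B(\Upsilon_{\lambda,t_0},(\Upsilon_{\lambda,t_0})^\perp)$, $t\in\mathcal I$, with $\mathcal M_{\lambda,t_0}=0$ and $\Upsilon_{\lambda,t}=\{\mathbf q+\mathcal M_{\lambda,t}\mathbf q:\mathbf q\in\Upsilon_{\lambda,t_0}\}$. The Maslov crossing form is $\mathfrak m_{t_0}(\mathbf q,\mathbf p):=\frac{d}{dt}\big|_{t=t_0}\widehat\omega(\mathbf q,\mathcal M_{\lambda,t}\mathbf p)=\widehat\omega(\mathbf q,\dot{\mathcal M}_{\lambda,t_0}\mathbf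 p)$ for $\mathbf p,\mathbf q\in\Upsilon_{\lambda,t_0}\cap\mathfrak D$. *)

(* Defs.v *)
From HB Require Import structures.
From mathcomp Require Export all_boot all_order all_algebra sesquilinear complex.
From mathcomp Require Export all_classical all_reals all_analysis.

Set Implicit Arguments.
Unset Strict Implicit.
Unset Printing Implicit Defensive.

Import Order.TTheory GRing.Theory Num.Theory numFieldNormedType.Exports.
Local Open Scope classical_set_scope.
Local Open Scope card_scope.
Local Open Scope ring_scope.
Local Open Scope complex_scope.

(* A complex Hilbert space is a Banach space over R[i] together with a positive
   definite form [ip : {dot H for Num.conj}] (linear in the first argument)
   which induces its norm. *)
Definition induces_norm (R : realType) (H : completeNormedModType R[i])
    (ip : {dot H for Num.conj}) : Prop :=
  forall x : H, `|x| ^+ 2 = ip x x.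

Definition separable_space (T : topologicalType) : Prop :=
  exists S : set T, countable S /\ dense S.

Section InnerProducts.
Context {R : realType}.
Notation C := R[i].

(* Direct sums carry the Hilbert inner product; the library norm on a product
   type is the (equivalent) max norm, and is not used below. *)
Definition ip_sum (E F : lmodType C) (ipE : E -> E -> C) (ipF : F -> F -> C)
    (x y : E * F) : C :=
  ipE x.1 y.1 + ipF x.2 y.2.

Definition ip_norm (E : lmodType C) (ip : E -> E -> C) (x : E) : R :=
  Num.sqrt (complex.Re (ip x x)).

Definition is_subspace (E : lmodType C) (M : set E) : Prop :=
  M 0 /\ forall (a : C) (x y : E), M x -> M y -> M (a *: x + y).

Definition orth_compl (E : lmodType C) (ip : E -> E -> C) (M : set E) : set E :=
  [set x | forall y, M y -> ip x y = 0].

Definition is_basis (E : lmodType C) (M : set E) n (e : 'I_n -> E) : Prop :=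
  (forall k, M (e k)) /\
  forall x, M x -> exists! c : 'rV[C]_n, x = \sum_k c 0 k *: e k.

Definition has_dim (E : lmodType C) (M : set E) (n : nat) : Prop :=
  exists e : 'I_n -> E, is_basis M e.

Definition fin_orthonormal_basis (E : lmodType C) (ip : E -> E -> C)
    (M : set E) n (e : 'I_n -> E) : Prop :=
  [/\ forall k, M (e k),
      forall k l, ip (e k) (e l) = (k == l)%:R
    & forall x, M x -> exists c : 'rV[C]_n, x = \sum_k c 0 k *: e k].

(* Orthonormal basis, of any cardinality, of a closed subspace [M]: a maximal
   orthonormal subset of [M]. *)
Definition hilbert_basis (E : lmodType C) (ip : E -> E -> C)
    (M B : set E) : Prop :=
  [/\ B `<=` M,
      forall x y, B x -> B y -> ip x y = (x == y)%:R
    & forall x, M x -> (forall y, B y -> ip x y = 0) -> x = 0].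

Definition same_hilbert_dim (E : lmodType C) (ip : E -> E -> C)
    (M N : set E) : Prop :=
  exists B B' : set E,
    [/\ hilbert_basis ip M B, hilbert_basis ip N B' & B #= B'].

End InnerProducts.

(* Bounded operators from a subspace [D] of [E] to [F] are functions [E -> F]
   of which only the restriction to [D] matters. *)
Section BoundedOperators.
Context {R : realType}.
Notation C := R[i].
Variables (E F : lmodType C) (D : set E).
Variables (ipE : E -> E -> C) (ipF : F -> F -> C).

Definition linear_on (L : E -> F) : Prop :=
  forall (a : C) (x y : E), D x -> D y -> L (a *: x + y) = a *: L x + L y.

Definition opnorm_le (L : E -> F) (c : R) : Prop :=
  forall x, D x -> ip_norm ipF (L x) <= c * ip_norm ipE x.

Definition bounded_op (L : E -> F) : Prop :=
  linear_on L /\ exists c : R, opnorm_le L c.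

(* [L] is C^1 on [J] in operator norm, with derivative [dL] (one-sided at the
   endpoints of [J] which belong to [J]). *)
Definition C1_on (J : set R) (L dL : R -> E -> F) : Prop :=
  [/\ forall t, J t -> bounded_op (L t) /\ bounded_op (dL t),
      forall t, J t -> forall e : R, 0 < e ->
        \forall s \near within J (nbhs t),
          opnorm_le (fun x => L s x - L t x - (s - t)%:C *: dL t x)
                    (e * `|s - t|)
    & forall t, J t -> forall e : R, 0 < e ->
        \forall s \near within J (nbhs t),
          opnorm_le (fun x => dL s x - dL t x) e].

End BoundedOperators.

Section ScalarDerivative.
Context {R : realType}.

Definition diff_quotient (f : R -> R[i]) (t s : R) : R[i]^o :=
  ((s - t)^-1)%:C * (f s - f t).

Definition is_derive_within (J : set R) (f : R -> R[i]) (t : R) (l : R[i]) :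
    Prop :=
  diff_quotient f t s @[s --> within J t^'] --> (l : R[i]^o).

Definition derive_within (J : set R) (f : R -> R[i]) (t : R) : R[i] :=
  lim (diff_quotient f t s @[s --> within J t^']).

(* The interval of [0,1] centered at [t0] with radius [r], relatively open in
   [0,1]. *)
Definition centered_interval (t0 r : R) : set R :=
  [set t | 0 <= t <= 1 /\ `|t - t0| < r].

End ScalarDerivative.

(* Unbounded operators: only the values on the domain matter. *)
Record operator (R : realType) (H : lmodType R[i]) :=
  Operator { dom : set H ; opfun :> H -> H }.

Section Operators.
Context {R : realType}.
Notation C := R[i].
Variables (H : completeNormedModType C) (ip : H -> H -> C).
Implicit Types (A B : operator H) (z : C).

Definition linear_op A : Prop := is_subspace (dom A) /\ linear_on (dom A) A.

Definition densely_defined A : Prop := dense (dom A).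

Definition closed_op A : Prop :=
  closed [set p : H * H | dom A p.1 /\ p.2 = A p.1].

Definition symmetric_op A : Prop :=
  forall u v, dom A u -> dom A v -> ip (A u) v = ip u (A v).

Definition extends A B : Prop :=
  dom A `<=` dom B /\ forall u, dom A u -> B u = A u.

(* For densely defined [A] the vector [w] is unique. *)
Definition adjoint A : operator H :=
  let rep v := [set w | forall u, dom A u -> ip (A u) v = ip u w] in
  Operator [set v | rep v !=set0] (fun v => xget 0 (rep v)).

Definition self_adjoint A : Prop :=
  [/\ linear_op A, densely_defined A, dom A = dom (adjoint A)
    & forall u, dom A u -> A u = adjoint A u].

Definition op_add A (V : H -> H) : operator H :=
  Operator (dom A) (fun u => A u + V u).

Definition op_shift A z : operator H :=
  Operator (dom A) (fun u => A u - z *: u).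

Definition ker_op A : set H := [set u | dom A u /\ A u = 0].

Definition bounded_self_adjoint (V : H -> H) : Prop :=
  bounded_op setT ip ip V /\ forall u v, ip (V u) v = ip u (V v).

Definition equal_deficiency_indices A : Prop :=
  same_hilbert_dim ip (ker_op (op_shift (adjoint A) 'i))
                      (ker_op (op_shift (adjoint A) (- 'i))).

Definition resolvent_set A : set C :=
  [set z | exists S : H -> H,
    [/\ bounded_op setT ip ip S,
        forall x, dom A (S x) /\ op_shift A z (S x) = x
      & forall u, dom A u -> S (op_shift A z u) = u]].

Definition spectrum A : set C := ~` resolvent_set A.

(* For self-adjoint operators, the only ones considered, the multiplicity of
   an isolated eigenvalue is the dimension of its eigenspace. *)
Definition discrete_spectrum A : set C :=
  [set z | [/\ spectrum A z,
      exists2 e : R, 0 < e &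
        forall w, spectrum A w -> `|w - z| < e%:C -> w = z,
      ker_op (op_shift A z) <> [set 0]
    & exists n, has_dim (ker_op (op_shift A z)) n]].

Definition ess_spectrum A : set C := spectrum A `\` discrete_spectrum A.

Definition ip_graph A (u v : H) : C := ip u v + ip (A u) (A v).

(* [lam] labels the eigenvalues of [Ht t] (repeated according to multiplicity)
   which bifurcate from the eigenvalue [l0] of [Ht t0], for [t] in [J] near
   [t0]. *)
Definition bifurcating_eigenvalues (J : set R) (Ht : R -> operator H)
    (t0 l0 : R) (m : nat) (lam : 'I_m -> R -> R) : Prop :=
  (forall j, lam j t0 = l0) /\
  exists e : R,
    [/\ 0 < e,
        forall z, `|z - l0%:C| < e%:C -> spectrum (Ht t0) z -> z = l0%:C
      & \forall t \near within J (nbhs t0),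
          (forall j, `|lam j t - l0| < e) /\
          forall z, `|z - l0%:C| < e%:C ->
            has_dim (ker_op (op_shift (Ht t) z))
                    #|[pred j | (lam j t)%:C == z]|].

End Operators.

Section Symplectic.
Context {R : realType}.
Notation C := R[i].
Variables (G : lmodType C) (ip : G -> G -> C).

Definition ip2 : G * G -> G * G -> C := ip_sum ip ip.

Definition Jsymp (f : G * G) : G * G := (f.2, - f.1).

Definition omega (f g : G * G) : C := ip2 (Jsymp f) g.

Definition lagrangian (F : set (G * G)) : Prop :=
  is_subspace F /\ F = [set f | forall g, F g -> omega f g = 0].

Definition orthogonal_projection (Q : G * G -> G * G) : Prop :=
  [/\ linear_on setT Q, forall p, Q (Q p) = Q p
    & forall p q, ip2 (Q p) q = ip2 p (Q q)].

Definition ip4 : (G * G) * (G * G) -> (G * G) * (G * G) -> C := ip_sum ip2 ip2.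

Definition omega_hat (f g : (G * G) * (G * G)) : C :=
  omega f.1 g.1 - omega f.2 g.2.

(* [Ups t], for [t] in [I], is the graph over [Ups t0] of a C^1 family of
   operators [M t] from [Ups t0] to its orthogonal complement. *)
Definition graph_family (I : set R) (t0 : R)
    (Ups : R -> set ((G * G) * (G * G)))
    (M : R -> (G * G) * (G * G) -> (G * G) * (G * G)) : Prop :=
  [/\ exists dM, C1_on (Ups t0) ip4 ip4 I M dM,
      forall t q, I t -> Ups t0 q -> orth_compl ip4 (Ups t0) (M t q),
      forall q, Ups t0 q -> M t0 q = 0
    & forall t, I t -> Ups t = [set q + M t q | q in Ups t0]].

Definition maslov_crossing_form (I : set R) (t0 : R)
    (M : R -> (G * G) * (G * G) -> (G * G) * (G * G))
    (q p : (G * G) * (G * G)) : C :=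
  derive_within I (fun t => omega_hat q (M t p)) t0.

End Symplectic.

Section BoundaryTriplets.
Context {R : realType}.
Notation C := R[i].
Variables (H : completeNormedModType C) (ipH : H -> H -> C).
Variables (G : lmodType C) (ipG : G -> G -> C).

(* Traces [T u = (Gamma_0 u, Gamma_1 u)], defined on the domain of the adjoint
   of [A] equipped with the graph inner product. *)
Definition boundary_triplet (A : operator H) (T : H -> G * G) : Prop :=
  let As := adjoint ipH A in
  [/\ bounded_op (dom As) (ip_graph ipH As) (ip2 ipG) T,
      forall p, exists2 u, dom As u & T u = p
    & forall u v, dom As u -> dom As v ->
        ipH (As u) v - ipH u (As v) =
        ipG (T u).2 (T v).1 - ipG (T u).1 (T v).2].

Definition trace_C1 (A : operator H) (J : set R) (T dT : R -> H -> G * G) :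
    Prop :=
  let As := adjoint ipH A in
  C1_on (dom As) (ip_graph ipH As) (ip2 ipG) J T dT.

Definition ker_adj (A : operator H) (V : H -> H) (l : C) : set H :=
  ker_op (op_shift (op_add (adjoint ipH A) V) l).

Definition upsilon (A : operator H) (T : H -> G * G) (V : H -> H)
    (Q : G * G -> G * G) (l : C) : set ((G * G) * (G * G)) :=
  [set x | (T @` ker_adj A V l) x.1 /\ range Q x.2].

End BoundaryTriplets.

(* Main.v *)
(** Write [D_t := A^* + V_t - l0] on [dom A^*].  A vector [q = (f, f)] with
    [f = T_{t0} u] is lifted to [q + M_t q = (T_t w_t, p_t)], where
    [D_t w_t = 0] and [p_t] lies in [ran Q_t].  Green's identity in the first
    component and the Lagrangian property of [ran Q_t] in the second one give
      [omega_hat (q, M_t q) = <(V_t - V_{t0}) u, w_t>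
         - omega ((T_t - T_{t0}) u, T_t w_t) + omega ((Q_t - Q_{t0}) f, p_t)],
    so the crossing form is the Hadamard-type expression once [w_t -> u].
    That convergence follows from [|z| <= K (|D_{t0} z| + |T_{t0} z|)], which
    is dual, through Green's identity, to the surjectivity of [D_{t0}]: since
    [l0] is isolated in the spectrum of the self-adjoint restriction of
    [D_{t0}], the range of the latter is the orthogonal complement of its
    finite-dimensional kernel, and a vector of this kernel orthogonal to
    [ran D_{t0}] has zero trace, hence lies in [dom A] and vanishes. *)
Require Import Defs.
From mathcomp Require Import ring lra.
Import Order.TTheory GRing.Theory Num.Theory numFieldNormedType.Exports.
Local Open Scope classical_set_scope.
Local Open Scope ring_scope.
Local Open Scope complex_scope.

(** * Semi-inner products *)

Section SemiInnerProduct.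
Set Implicit Arguments.
Unset Strict Implicit.
Import ComplexField.Normc.
Context {R : realType}.
Notation C := R[i].

(** One predicate covers the given [{dot}] forms as well as their sums [ip_sum], which are plain
    functions; definiteness enters later through [induces_norm]. *)
Definition semi_inner_product (E : lmodType C) (ip : E -> E -> C) : Prop :=
  [/\ forall a x y z, ip (a *: x + y) z = a * ip x z + ip y z,
      forall x y, ip x y = conjc (ip y x)
    & forall x, 0 <= ip x x].

Lemma dot_semi_inner (E : lmodType C) (ip : {dot E for Num.conj}) :
  semi_inner_product ip.
Proof.
split=> [a x y z|x y|x]; first exact: linearPl.
- by rewrite (hermC ip) expr0 mul1r.
- have [->|x0] := eqVneq x 0; first by rewrite linear0l.
  exact/ltW/neq0_dnorm_gt0.
Qed.

Lemma ip_sum_semi_inner (E F : lmodType C) ipE ipF :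
  semi_inner_product (ipE : E -> E -> C) ->
  semi_inner_product (ipF : F -> F -> C) ->
  semi_inner_product (ip_sum ipE ipF).
Proof.
move=> [lE cE pE] [lF cF pF]; split=> [a x y z|x y|x].
- by rewrite /ip_sum /= lE lF mulrDr addrACA.
- by rewrite /ip_sum rmorphD /= -cE -cF.
- by rewrite addr_ge0.
Qed.

Lemma Re_le_normc (z : C) : complex.Re z <= normc z.
Proof.
case: z => a b /=; apply: le_trans (ler_norm _) _.
by rewrite -sqrtr_sqr ler_sqrt ?lerDl ?addr_ge0 ?sqr_ge0.
Qed.

Lemma normc_ge0 (z : C) : 0 <= normc z.
Proof. by case: z => a b /=; rewrite sqrtr_ge0. Qed.

Lemma normcS (z : C) : normc z ^+ 2 = complex.Re (conjc z * z).
Proof.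
case: z => a b /=; rewrite sqr_sqrtr ?addr_ge0 ?sqr_ge0 //; ring.
Qed.

Lemma normcR (x : R) : normc x%:C = `|x|.
Proof. by rewrite /= expr0n addr0 sqrtr_sqr. Qed.

Lemma normC_norm (z : C) : `|z| = (normc z)%:C.
Proof. by []. Qed.

(** The factor [N] in the quadratic coefficient is the shape produced by [nrm_sqrBZ], where [N] is
    the squared modulus of an inner product. For [Y > 0] the value [s = 1 / Y] suffices; for [Y = 0]
    a large [s] excludes [N > 0]. *)
Lemma discriminant_le (X N Y : R) : 0 <= X -> 0 <= N -> 0 <= Y ->
  (forall s, 0 <= X - 2 * s * N + s ^+ 2 * N * Y) -> N <= X * Y.
Proof.
move=> X0 N0 Y0 h; have [Yp|Yn] := ltP 0 Y.
  have /(mulr_ge0 (ltW Yp)) := h Y^-1.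
  rewrite (_ : Y * _ = X * Y - N) ?subr_ge0 //.
  by field; rewrite gt_eqF.
have {Yn} Y00 : Y = 0 by apply/le_anti; rewrite Yn.
rewrite Y00 mulr0 leNgt; apply/negP => Np.
have := h ((X + 1) / N); rewrite Y00 mulr0 addr0.
rewrite (_ : _ - _ = - X - 2); first by lra.
by field; rewrite gt_eqF.
Qed.

Section Theory.
Variables (E : lmodType C) (ip : E -> E -> C).
Hypothesis hip : semi_inner_product ip.
Local Notation nrm := (ip_norm ip).

Lemma ipC x y : ip x y = conjc (ip y x). Proof. by case: hip. Qed.

Lemma ipDl x y z : ip (x + y) z = ip x z + ip y z.
Proof. by case: hip => l _ _; rewrite -[x]scale1r l mul1r scale1r. Qed.

Lemma ip0l z : ip 0 z = 0.
Proof. by apply/(addIr (ip 0 z)); rewrite -ipDl addr0 add0r. Qed.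

Lemma ipZl a x z : ip (a *: x) z = a * ip x z.
Proof. by case: hip => l _ _; rewrite -[a *: x]addr0 l ip0l addr0. Qed.

Lemma ipNl x z : ip (- x) z = - ip x z.
Proof. by rewrite -scaleN1r ipZl mulN1r. Qed.

Lemma ipBl x y z : ip (x - y) z = ip x z - ip y z.
Proof. by rewrite ipDl ipNl. Qed.

Lemma ipDr x y z : ip x (y + z) = ip x y + ip x z.
Proof. by rewrite ipC ipDl rmorphD /= -!ipC. Qed.

Lemma ip0r x : ip x 0 = 0.
Proof. by rewrite ipC ip0l rmorph0. Qed.

Lemma ipZr a x z : ip x (a *: z) = conjc a * ip x z.
Proof. by rewrite ipC ipZl rmorphM /= -ipC. Qed.

Lemma ipNr x z : ip x (- z) = - ip x z.
Proof. by rewrite ipC ipNl rmorphN /= -ipC. Qed.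

Lemma ipBr x y z : ip x (y - z) = ip x y - ip x z.
Proof. by rewrite ipDr ipNr. Qed.

Lemma ip_suml I (r : seq I) (F : I -> E) z :
  ip (\sum_(i <- r) F i) z = \sum_(i <- r) ip (F i) z.
Proof. by apply: (big_morph (ip^~ z)) => [x y|]; rewrite ?ipDl ?ip0l. Qed.

Lemma Re_ipC x y : complex.Re (ip x y) = complex.Re (ip y x).
Proof. by rewrite ipC; case: (ip y x). Qed.

Lemma nrm_ge0 x : 0 <= nrm x. Proof. exact: sqrtr_ge0. Qed.

Lemma nrm_sqr x : nrm x ^+ 2 = complex.Re (ip x x).
Proof.
rewrite sqr_sqrtr //; case: hip => _ _ /(_ x).
by rewrite lecE => /andP[].
Qed.

Lemma ip_self x : ip x x = (nrm x ^+ 2)%:C.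
Proof.
rewrite nrm_sqr RRe_real //; case: hip => _ _ /(_ x).
exact: ger0_real.
Qed.

Lemma nrm_sqrD x y :
  nrm (x + y) ^+ 2 = nrm x ^+ 2 + 2 * complex.Re (ip x y) + nrm y ^+ 2.
Proof.
rewrite !nrm_sqr !ipDl !ipDr !raddfD /= (Re_ipC y x) mulr2n mulrDl !mul1r.
by rewrite !addrA.
Qed.

Lemma nrm0 : nrm 0 = 0. Proof. by rewrite /ip_norm ip0l sqrtr0. Qed.

Lemma nrmZ a x : nrm (a *: x) = normc a * nrm x.
Proof.
apply/eqP; rewrite -(@eqrXn2 _ 2) ?mulr_ge0 ?nrm_ge0 ?normc_ge0 //.
rewrite nrm_sqr ipZl ipZr mulrA exprMn normcS [_ * a]mulrC ip_self.
by case: a => a b /=; rewrite mulr0 subr0.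
Qed.

Lemma nrmN x : nrm (- x) = nrm x.
Proof. by rewrite /ip_norm ipNl ipNr opprK. Qed.

Lemma nrmBC x y : nrm (x - y) = nrm (y - x).
Proof. by rewrite -opprB nrmN. Qed.

Lemma nrm_sqrB x y :
  nrm (x - y) ^+ 2 = nrm x ^+ 2 - 2 * complex.Re (ip x y) + nrm y ^+ 2.
Proof. by rewrite nrm_sqrD ipNr raddfN mulrN nrmN. Qed.

(** The coefficient [s <x, y>] carries the phase of the inner product, so the expansion is a real
    quadratic in [s]. *)
Lemma nrm_sqrBZ (s : R) x y :
  nrm (x - (s%:C * ip x y) *: y) ^+ 2 =
  nrm x ^+ 2 - 2 * s * normc (ip x y) ^+ 2
  + s ^+ 2 * normc (ip x y) ^+ 2 * nrm y ^+ 2.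
Proof.
rewrite nrm_sqrB ipZr nrmZ normcM normcR !exprMn real_normK ?num_real // normcS.
by case: (ip x y) => a b /=; ring.
Qed.

Lemma ip_CauchySchwarz x y : normc (ip x y) <= nrm x * nrm y.
Proof.
rewrite -(@ler_pXn2r _ 2) ?nnegrE ?mulr_ge0 ?nrm_ge0 ?normc_ge0 // exprMn.
apply: discriminant_le => [|||s]; rewrite ?sqr_ge0 // -nrm_sqrBZ.
exact: sqr_ge0.
Qed.

Lemma nrmD x y : nrm (x + y) <= nrm x + nrm y.
Proof.
rewrite -(@ler_pXn2r _ 2) ?nnegrE ?addr_ge0 ?nrm_ge0 // nrm_sqrD sqrrD.
rewrite lerD2r lerD2l -[_ * _ *+ 2]mulr_natl ler_pM2l //.
exact: le_trans (Re_le_normc _) (ip_CauchySchwarz _ _).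
Qed.

Lemma nrmB x y : nrm (x - y) <= nrm x + nrm y.
Proof. by apply: le_trans (nrmD _ _) _; rewrite nrmN. Qed.

Lemma nrm_dist x y z : nrm (x - z) <= nrm (x - y) + nrm (y - z).
Proof. by apply: le_trans (nrmD _ _); rewrite addrA subrK. Qed.

Lemma nrm_sum I (r : seq I) (F : I -> E) :
  nrm (\sum_(i <- r) F i) <= \sum_(i <- r) nrm (F i).
Proof.
elim/big_ind2: _ => [|x a y b xa yb|//]; first by rewrite nrm0.
exact: le_trans (nrmD _ _) (lerD xa yb).
Qed.

(* A near-minimizer [a] of the distance from [h] to [M] makes [h - a] nearly
   orthogonal to [M]: this replaces the orthogonal projection, and does not
   need completeness. *)
Lemma approx_projection (M : set E) h (e : R) : is_subspace M -> 0 < e ->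
  exists2 a, M a & forall b, M b -> normc (ip (h - a) b) <= e * nrm b.
Proof.
move=> [M0 Ml] e0.
pose D : set R := [set nrm (h - a) ^+ 2 | a in M].
have Dinf : has_inf D.
  split; first by exists (nrm (h - 0) ^+ 2), 0.
  by exists 0 => _ [a _ <-]; exact: sqr_ge0.
have [_ [a Ma <-] ha] := @inf_adherent _ D (e ^+ 2) (exprn_gt0 _ e0) Dinf.
exists a => // b Mb.
rewrite -(@ler_pXn2r _ 2) ?nnegrE ?mulr_ge0 ?nrm_ge0 ?normc_ge0 ?(ltW e0) //.
rewrite exprMn; apply: discriminant_le => [|||s]; rewrite ?sqr_ge0 //.
(* Moving [a] by a multiple of [b] stays in [M], so it lowers the squared distance by less than
   [e ^ 2]; this is the quadratic inequality with [X = e ^ 2]. *)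
have : inf D <= nrm (h - a - (s%:C * ip (h - a) b) *: b) ^+ 2.
  apply: ge_inf; first by case: Dinf.
  exists ((s%:C * ip (h - a) b) *: b + a); first exact: Ml.
  by rewrite opprD addrA addrAC.
rewrite nrm_sqrBZ; lra.
Qed.

(* Comparing [a] and [a'] with the almost orthogonal vector [a - a']. *)
Lemma approx_projection_close (M : set E) h a a' (e e' : R) : is_subspace M ->
  M a -> M a' ->
  (forall b, M b -> normc (ip (h - a) b) <= e * nrm b) ->
  (forall b, M b -> normc (ip (h - a') b) <= e' * nrm b) ->
  0 <= e -> 0 <= e' -> nrm (a - a') <= e + e'.
Proof.
move=> [M0 Ml] Ma Ma' h1 h2 e0 e0'.
have Mb : M (a - a') by rewrite addrC -scaleN1r; exact: Ml.
have [n0|n0] := leP (nrm (a - a')) 0; first by rewrite (le_trans n0) ?addr_ge0.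
rewrite -(ler_pM2r n0) -expr2 nrm_sqr.
have -> : ip (a - a') (a - a') = ip (h - a') (a - a') - ip (h - a) (a - a').
  rewrite -ipBl; congr ip; rewrite opprB [RHS]addrC addrA subrK //.
apply: le_trans (Re_le_normc _) _; apply: le_trans (le_normcD _ _) _.
by rewrite normcN addrC mulrDl lerD ?h1 ?h2.
Qed.

End Theory.

Lemma nrm_fst_le (E F : lmodType C) ipE ipF (p : E * F) :
  semi_inner_product (ipE : E -> E -> C) ->
  semi_inner_product (ipF : F -> F -> C) ->
  ip_norm ipE p.1 <= ip_norm (ip_sum ipE ipF) p.
Proof.
move=> hE hF; have hEF := ip_sum_semi_inner hE hF.
rewrite -(@ler_pXn2r _ 2) ?nnegrE ?nrm_ge0 // (nrm_sqr hE) (nrm_sqr hEF).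
by rewrite raddfD /= lerDl -(nrm_sqr hF) sqr_ge0.
Qed.

Lemma nrm_snd_le (E F : lmodType C) ipE ipF (p : E * F) :
  semi_inner_product (ipE : E -> E -> C) ->
  semi_inner_product (ipF : F -> F -> C) ->
  ip_norm ipF p.2 <= ip_norm (ip_sum ipE ipF) p.
Proof.
move=> hE hF; have hEF := ip_sum_semi_inner hE hF.
rewrite -(@ler_pXn2r _ 2) ?nnegrE ?nrm_ge0 // (nrm_sqr hF) (nrm_sqr hEF).
by rewrite raddfD /= lerDr -(nrm_sqr hE) sqr_ge0.
Qed.

End SemiInnerProduct.

(** * Spectral gap of a symmetric operator *)

Section SpectralGap.
Set Implicit Arguments.
Unset Strict Implicit.
Import ComplexField.Normc.
Context {R : realType}.
Notation C := R[i].

Section LinearOn.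
Variables (E F : lmodType C) (D : set E) (L : E -> F).
Hypotheses (hD : is_subspace D) (hL : linear_on D L).

Lemma subspaceD x y : D x -> D y -> D (x + y).
Proof. by move=> Dx Dy; rewrite -[x]scale1r; exact: hD.2. Qed.

Lemma subspaceZ a x : D x -> D (a *: x).
Proof. by move=> Dx; rewrite -[_ *: _]addr0; apply: hD.2 => //;
  exact: hD.1. Qed.

Lemma subspaceB x y : D x -> D y -> D (x - y).
Proof.
by move=> Dx Dy; apply: subspaceD => //; rewrite -scaleN1r; exact: subspaceZ.
Qed.

Lemma subspace_sum I (r : seq I) (f : I -> E) :
  (forall i, D (f i)) -> D (\sum_(i <- r) f i).
Proof.
move=> Df; elim/big_ind: _ => //; [exact: hD.1|exact: subspaceD].
Qed.

Lemma linear_onD x y : D x -> D y -> L (x + y) = L x + L y.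
Proof. by move=> Dx Dy; rewrite -[x]scale1r hL // !scale1r. Qed.

Lemma linear_on0 : L 0 = 0.
Proof.
have D0 := hD.1.
by apply: (addIr (L 0)); rewrite -linear_onD // addr0 add0r.
Qed.

Lemma linear_onZ a x : D x -> L (a *: x) = a *: L x.
Proof.
have D0 := hD.1.
by move=> Dx; rewrite -[a *: x]addr0 hL // linear_on0 addr0.
Qed.

Lemma linear_onB x y : D x -> D y -> L (x - y) = L x - L y.
Proof.
move=> Dx Dy; rewrite linear_onD //.
  by rewrite -scaleN1r linear_onZ // scaleN1r.
by rewrite -scaleN1r; exact: subspaceZ.
Qed.

Lemma linear_on_sum I (r : seq I) (f : I -> E) : (forall i, D (f i)) ->
  L (\sum_(i <- r) f i) = \sum_(i <- r) L (f i).
Proof.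
move=> Df; elim: r => [|i r ih]; first by rewrite !big_nil linear_on0.
by rewrite !big_cons linear_onD ?ih //; exact: subspace_sum.
Qed.

End LinearOn.

Lemma subspace_setT (E : lmodType C) : is_subspace [set: E].
Proof. by []. Qed.

Variables (E : lmodType C) (ip : E -> E -> C).
Hypothesis hip : semi_inner_product ip.
Local Notation nrm := (ip_norm ip).

Lemma Re_mulR (a : R) (z : C) : complex.Re (a%:C * z) = a * complex.Re z.
Proof. by case: z => b d /=; rewrite mul0r subr0. Qed.

Lemma nrm_symmetric_sqrB (Z : E -> E) (s : R) x :
  (forall x y, ip (Z x) y = ip x (Z y)) ->
  nrm (Z (Z x) - (s ^+ 2)%:C *: x) ^+ 2 =
  nrm (Z (Z x)) ^+ 2 - 2 * s ^+ 2 * nrm (Z x) ^+ 2 + s ^+ 4 * nrm x ^+ 2.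
Proof.
move=> Zs; rewrite (nrm_sqrB hip) (ipZr hip) conjc_real (nrmZ hip) normcR.
rewrite exprMn real_normK ?num_real // -exprM Zs (ip_self hip) Re_mulR mulrA.
by [].
Qed.

(* Writing [a] for the square of the best lower bound of [Z], the operator
   [Z ^ 2 - a] is positive, so its square is controlled by its quadratic form;
   if both factors of [(Z - sqrt a) (Z + sqrt a)] were bounded below, the bound
   [a] could be improved. *)
Lemma symmetric_lower_bound (Z : E -> E) (c nu : R) :
  linear_on setT Z -> (forall x y, ip (Z x) y = ip x (Z y)) ->
  (forall x, nrm (Z x) <= c * nrm x) -> 0 <= c -> 0 < nu ->
  (forall s : R, `|s| < nu ->
     exists2 k : R, 0 < k & forall x, k * nrm x <= nrm (Z x - s%:C *: x)) ->
  forall x, nu * nrm x <= nrm (Z x).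
Proof.
move=> Zl Zs Zc c0 nu0 hk x0; rewrite leNgt; apply/negP => hx0.
have n0 : 0 < nrm x0.
  rewrite lt_neqAle nrm_ge0 andbT eq_sym; apply/eqP => n0.
  by move: hx0; rewrite n0 mulr0 ltNge nrm_ge0.
pose S : set R := [set a | 0 <= a /\ forall x, a * nrm x ^+ 2 <= nrm (Z x) ^+
  2].
have Slt a : S a -> a < nu ^+ 2.
  move=> [a0 /(_ x0) ha]; rewrite -(ltr_pM2r (exprn_gt0 2 n0)).
  apply: le_lt_trans ha _; rewrite -exprMn.
  by rewrite ltr_pXn2r ?nnegrE ?nrm_ge0 ?mulr_ge0 ?nrm_ge0 ?(ltW nu0).
have S0 : S 0 by split=> // x; rewrite mul0r sqr_ge0.
have Ssup : has_sup S by split; [exists 0 | exists (nu ^+ 2) => a /Slt/ltW].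
pose a := sup S.
have a0 : 0 <= a by apply: sup_upper_bound.
have Sa : S a.
  split=> // x; have [->|x00] := eqVneq (nrm x) 0.
    by rewrite expr0n mulr0 sqr_ge0.
  have xp : 0 < nrm x ^+ 2 by rewrite exprn_gt0 // lt_neqAle eq_sym x00 nrm_ge0.
  rewrite -ler_pdivlMr //; apply: ge_sup; first by exists 0.
  by move=> b [_ /(_ x)]; rewrite ler_pdivlMr.
pose s := Num.sqrt a.
have s0 : 0 <= s by exact: sqrtr_ge0.
have s2 : s ^+ 2 = a by rewrite sqr_sqrtr.
have slt : `|s| < nu.
  rewrite ger0_norm // -(@ltr_pXn2r _ 2) ?nnegrE ?(ltW nu0) // s2.
  exact: Slt.
have [k1 k10 hk1] := hk s slt.
have [k2 k20 hk2] := hk (- s) (ltac:(by rewrite normrN)).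
pose P x := Z (Z x) - (s ^+ 2)%:C *: x.
have PE x : Z (Z x + s%:C *: x) - s%:C *: (Z x + s%:C *: x) = P x.
  rewrite (linear_onD Zl) // (linear_onZ (@subspace_setT E) Zl) // scalerDr.
  by rewrite scalerA -rmorphM -expr2 addrKA.
have Plow x : k1 * k2 * nrm x <= nrm (P x).
  rewrite -PE; apply: le_trans (hk1 _); rewrite -mulrA ler_pM2l //.
  by apply: le_trans (hk2 _) _; rewrite rmorphN scaleNr opprK.
pose q x := nrm (Z x) ^+ 2 - a * nrm x ^+ 2.
have q0 x : 0 <= q x by rewrite subr_ge0; case: Sa => _; apply.
pose cp := c ^+ 2 + a + 1.
have cp0 : 0 < cp by rewrite /cp ltr_wpDl ?addr_ge0 ?sqr_ge0.
have Pup x : nrm (P x) <= cp * nrm x.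
  apply: le_trans (nrmB hip _ _) _.
  rewrite (nrmZ hip) normcR s2 ger0_norm // /cp !mulrDl mul1r.
  apply: le_trans (_ : c ^+ 2 * nrm x + a * nrm x <= _); last first.
    by rewrite lerDl nrm_ge0.
  rewrite lerD2r expr2 -mulrA; apply: le_trans (Zc _) _.
  by rewrite ler_wpM2l.
have qE x : complex.Re (ip (P x) x) = q x.
  rewrite (ipBl hip) Zs (ipZl hip) !(ip_self hip) s2 raddfB /=.
  by rewrite mul0r subr0.
have PB x y : P (x - y) = P x - P y.
  rewrite /P !(linear_onB (@subspace_setT E) Zl) // scalerBr.
  by rewrite !opprD !opprK addrACA.
have Ps x y : ip (P x) y = ip x (P y).
  by rewrite (ipBl hip) (ipBr hip) !Zs (ipZl hip) (ipZr hip) conjc_real.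
have PZ (t : R) x : P (t%:C *: x) = t%:C *: P x.
  rewrite /P !(linear_onZ (@subspace_setT E) Zl) // scalerBr !scalerA.
  by rewrite [_%:C * _%:C]mulrC.
have Pq x : nrm (P x) ^+ 2 <= cp * q x.
  (* positivity of [q] at [x - P x / cp] *)
  have := q0 (x - (cp^-1)%:C *: P x).
  rewrite -qE PB PZ (ipBl hip) !(ipBr hip) !(ipZl hip) !(ipZr hip) !conjc_real.
  rewrite !raddfB /= !Re_mulR qE (Ps (P x) x) -(nrm_sqr hip).
  have h : complex.Re (ip (P (P x)) (P x)) <= cp * nrm (P x) ^+ 2.
    apply: le_trans (Re_le_normc _) _.
    apply: le_trans (ip_CauchySchwarz hip _ _) _.
    by rewrite expr2 mulrA ler_wpM2r ?nrm_ge0.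
  move: h; set N := nrm (P x) ^+ 2; set r := complex.Re _ => h pos.
  have : cp^-1 * r <= N by rewrite ler_pdivrMl.
  rewrite -(ler_pM2l (_ : 0 < cp^-1)) ?invr_gt0 // => h2.
  by rewrite -ler_pdivrMl //; lra.
(* [Plow] and [Pq] together give [(k1 k2)^2 |x|^2 <= cp q(x)], so the squared lower bound could be
   raised above its supremum. *)
have : S (a + (k1 * k2) ^+ 2 / cp).
  split=> [|x]; first by rewrite addr_ge0 ?divr_ge0 ?sqr_ge0 ?(ltW cp0).
  rewrite mulrDl -lerBrDl -/(q x) mulrAC ler_pdivrMr // [q x * _]mulrC.
  apply: le_trans (Pq x); rewrite -exprMn.
  rewrite ler_pXn2r ?nnegrE ?nrm_ge0 ?mulr_ge0 ?nrm_ge0 ?(ltW k10) ?(ltW k20)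
    //.
move/(sup_upper_bound Ssup); rewrite -/a gerDl leNgt.
by rewrite divr_gt0 // exprn_gt0 // mulr_gt0.
Qed.

(** Away from 0, the spectrum of [L] avoids [(-d, d)], so that of [Z = L^2 - nu] with [nu = d^2 / 2]
    avoids [(-nu, nu)], and [symmetric_lower_bound] gives [|Z x| >= nu |x|]. After squaring, the
    terms [nu^2 |x|^2] cancel and leave [|L^2 x|^2 >= 2 nu |L x|^2]. *)
Lemma symmetric_gap (L : E -> E) (c d : R) :
  linear_on setT L -> (forall x y, ip (L x) y = ip x (L y)) ->
  (forall x, nrm (L x) <= c * nrm x) -> 0 <= c -> 0 < d ->
  (forall s : R, 0 < `|s| -> `|s| < d ->
     exists2 k : R, 0 < k & forall x, k * nrm x <= nrm (L x - s%:C *: x)) ->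
  forall x, d * nrm (L x) <= nrm (L (L x)).
Proof.
move=> Ll Ls Lc c0 d0 hk x; have d0' := ltW d0.
have Tl := linear_onB (@subspace_setT E) Ll.
have TZ a y : L (a *: y) = a *: L y.
  by rewrite (linear_onZ (@subspace_setT E) Ll).
pose nu := d ^+ 2 / 2.
have nu0 : 0 < nu by rewrite divr_gt0 ?exprn_gt0.
pose Z y := L (L y) - nu%:C *: y.
have hZ : nu * nrm x <= nrm (Z x).
  apply: (@symmetric_lower_bound Z (c ^+ 2 + nu)) => //.
  - by move=> a y z _ _; rewrite /Z !Ll // scalerBr scalerDr scalerA mulrC
    -scalerA opprD addrACA.
  - move=> y z; rewrite /Z (ipBl hip) (ipBr hip) !Ls (ipZl hip) (ipZr hip).
    by rewrite conjc_real.
  - move=> y; apply: le_trans (nrmB hip _ _) _.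
    rewrite (nrmZ hip) normcR gtr0_norm // mulrDl lerD2r expr2 -mulrA.
    by apply: le_trans (Lc _) _; rewrite ler_wpM2l.
  - by rewrite addr_ge0 ?sqr_ge0 // ltW.
  move=> s; rewrite ltr_norml => /andP[s1 s2].
  have r0 : 0 < nu + s by lra.
  (* [Z - s] factors as [(L - r) (L + r)], with [0 < r < d] because [nu + s] lies strictly between 0
     and [d ^ 2]. *)
  pose r := Num.sqrt (nu + s).
  have rE : r ^+ 2 = nu + s by rewrite sqr_sqrtr // ltW.
  have rp : 0 < r by rewrite sqrtr_gt0.
  have rd : r < d.
    rewrite -(@ltr_pXn2r _ 2) ?nnegrE ?(ltW rp) ?(ltW d0) // rE.
    by move: s2; rewrite /nu; lra.
  have [||k1 k10 hk1] := hk r; rewrite ?gtr0_norm //.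
  have [||k2 k20 hk2] := hk (- r); rewrite ?normrN ?gtr0_norm //.
  exists (k1 * k2) => [|y]; first exact: mulr_gt0.
  have -> : Z y - s%:C *: y = L (L y + r%:C *: y) - r%:C *: (L y + r%:C *: y).
    rewrite (linear_onD Ll) // TZ scalerDr scalerA -rmorphM -expr2 rE addrKA.
    by rewrite /Z rmorphD scalerDl opprD addrA.
  apply: le_trans (hk1 _); rewrite -mulrA ler_pM2l //.
  by apply: le_trans (hk2 _) _; rewrite rmorphN scaleNr opprK.
move: hZ; rewrite -(@ler_pXn2r _ 2) ?nnegrE ?nrm_ge0 ?mulr_ge0 ?nrm_ge0 ?(ltW
  nu0) //.
have nuE : nu = Num.sqrt nu ^+ 2 by rewrite sqr_sqrtr // ltW.
rewrite /Z {2}nuE nrm_symmetric_sqrB // -nuE.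
rewrite (_ : Num.sqrt nu ^+ 4 = nu ^+ 2); last by rewrite {2}nuE -exprM.
rewrite exprMn => h.
rewrite -(@ler_pXn2r _ 2) ?nnegrE ?nrm_ge0 ?mulr_ge0 ?nrm_ge0 ?(ltW d0) //.
rewrite exprMn (_ : d ^+ 2 = 2 * nu); first by lra.
by rewrite /nu mulrC divfK ?pnatr_eq0.
Qed.

End SpectralGap.

(** * Hilbert spaces *)

Section HilbertSpace.
Set Implicit Arguments.
Unset Strict Implicit.
Import ComplexField.Normc.
Context {R : realType}.
Notation C := R[i].
Variables (H : completeNormedModType C) (ip : {dot H for Num.conj}).
Hypothesis hip : induces_norm ip.
Local Notation nrm := (ip_norm ip).
Let hsemi := dot_semi_inner ip.

Lemma norm_nrm (x : H) : `|x| = (nrm x)%:C.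
Proof.
apply/eqP; rewrite -(@eqrXn2 _ 2) //; last first.
  by rewrite lecR; exact: nrm_ge0.
by rewrite hip (ip_self hsemi) rmorphXn.
Qed.

Lemma nrm_eq0 (x : H) : nrm x = 0 -> x = 0.
Proof. by move=> x0; apply/normr0_eq0; rewrite norm_nrm x0. Qed.

Lemma nrm_le0 (x : H) : nrm x <= 0 -> x = 0.
Proof. by move=> x0; apply/nrm_eq0/le_anti; rewrite x0 nrm_ge0. Qed.

Lemma ip_eq0 (x : H) : ip x x = 0 -> x = 0.
Proof.
rewrite (ip_self hsemi) => -[/eqP]; rewrite sqrf_eq0 => /eqP; exact: nrm_eq0.
Qed.

Lemma gt0_complex (e : C) : 0 < e -> exists2 r : R, 0 < r & e = r%:C.
Proof.
move=> e0; exists (complex.Re e); last by rewrite RRe_real // gtr0_real.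
by move: e0; rewrite ltcE => /andP[].
Qed.

Lemma harmonic_small (e : R) : 0 < e -> exists n : nat, n.+1%:R^-1 < e.
Proof.
move=> e0; have := near_infty_natSinv_lt (PosNum e0).
by move=> [N _ /(_ N (leqnn N))]; exists N.
Qed.

Lemma harmonic_le0 (a K : R) : (forall n : nat, a <= K * n.+1%:R^-1) -> a <= 0.
Proof.
move=> h; rewrite leNgt; apply/negP => a0.
have K0 : 0 < K by have := lt_le_trans a0 (h 0%N); rewrite invr1 mulr1.
have [n hn] := harmonic_small (divr_gt0 a0 K0).
have := h n; rewrite leNgt mulrC -ltr_pdivlMr //; by rewrite hn.
Qed.

Lemma harmonic_le (m n : nat) : (m <= n)%N -> n.+1%:R^-1 <= m.+1%:R^-1 :> R.
Proof. by move=> mn; rewrite lef_pV2 ?posrE // ler_nat ltnS. Qed.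

(** Keeping the explicit rate [K / (n + 1)] turns later passages to the limit into inequalities
    settled by [harmonic_le0]. *)
Lemma complete_sequence (x : nat -> H) (K : R) : 0 <= K ->
  (forall n m, nrm (x n - x m) <= K * (n.+1%:R^-1 + m.+1%:R^-1)) ->
  exists l, forall n, nrm (x n - l) <= K * n.+1%:R^-1.
Proof.
move=> K0 hx.
have : cauchy (x @ \oo).
  apply: cauchy_exP => e /gt0_complex[r r0 ->].
  have K1 : 0 < 2 * (K + 1) by rewrite mulr_gt0 // ltr_wpDl.
  have [N hN] := harmonic_small (divr_gt0 r0 K1).
  exists (x N); exists N => // n /= Nn.
  rewrite -ball_normE /ball_ /= norm_nrm ltcR.
  apply: le_lt_trans (hx _ _) _.
  have := hN; rewrite ltr_pdivlMr ?mulr_gt0 ?ltr_wpDl // => h.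
  have := harmonic_le Nn; have := K0; move: h; set a := N.+1%:R^-1;
    set b := n.+1%:R^-1.
  have a0 : 0 < a by rewrite invr_gt0.
  nra.
move/cauchy_cvgP/cvg_ex => [l xl]; exists l => n.
rewrite -subr_le0; apply: (@harmonic_le0 _ (K + 1)) => k.
have : \forall m \near \oo, nrm (x m - l) <= k.+1%:R^-1.
  have := @cvgr_dist_le _ _ _ _ _ _ _ xl (k.+1%:R^-1)%:C.
  rewrite ltcR invr_gt0 ltr0Sn => /(_ _ isT); apply: filterS => m.
  by rewrite norm_nrm lecR (nrmBC hsemi).
move=> [N _ hN]; pose m := maxn N k.
have h1 := hN m (leq_maxl _ _).
have h2 := harmonic_le (leq_maxr N k : (k <= m)%N).
have := hx n m; have := nrm_dist hsemi (x n) (x m) l.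
have : K * m.+1%:R^-1 <= K * k.+1%:R^-1 by rewrite ler_wpM2l.
move: h1; rewrite mulrDr mulrDl mul1r.
set a := K * n.+1%:R^-1; set b := K * m.+1%:R^-1; set c := K * k.+1%:R^-1.
set a' := nrm _; set b' := nrm _; set c' := nrm _; set d := k.+1%:R^-1.
lra.
Qed.

Lemma nrm_limit_cvg (x : nat -> H) l (K : R) :
  (forall n, nrm (x n - l) <= K * n.+1%:R^-1) -> x n @[n --> \oo] --> l.
Proof.
move=> hx; have K0 : 0 <= K.
  by have := hx 0%N; rewrite invr1 mulr1; apply: le_trans; exact: nrm_ge0.
apply/cvgrPdist_le => e /gt0_complex[r r0 ->].
have K1 : 0 < K + 1 by rewrite ltr_wpDl.
have [N hN] := harmonic_small (divr_gt0 r0 K1).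
exists N => // n /= Nn; rewrite norm_nrm lecR (nrmBC hsemi).
apply: le_trans (hx n) _.
have := hN; rewrite ltr_pdivlMr ?ltr_wpDl // => h.
have := harmonic_le Nn; move: h; set a := N.+1%:R^-1; set b := n.+1%:R^-1.
have a0 : 0 < a by rewrite invr_gt0.
nra.
Qed.

Lemma limit_orthogonal (x : nat -> H) l k (K : R) :
  (forall n, nrm (x n - l) <= K * n.+1%:R^-1) -> (forall n, ip (x n) k = 0) ->
  ip l k = 0.
Proof.
move=> hx xk; apply: eq0_normc; apply/le_anti; rewrite normc_ge0 andbT.
apply: (@harmonic_le0 _ (K * nrm k)) => n.
rewrite -[l](subKr (x n)) (ipBl hsemi) xk sub0r normcN.
apply: le_trans (ip_CauchySchwarz hsemi _ _) _.
by rewrite mulrAC ler_wpM2r // nrm_ge0.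
Qed.

(** Density gives some [u] in [D] with [|w - u| < |w|], while [|w|^2 = <w - u, w>] forces
    [|w - u| >= |w|]. *)
Lemma dense_orthogonal (D : set H) w : dense D -> (forall u, D u -> ip u w = 0)
  ->
  w = 0.
Proof.
move=> Dd Dw; apply: nrm_le0; rewrite leNgt; apply/negP => w0.
have [] := Dd (ball w (nrm w)%:C); last first.
- move=> u [+ Du]; rewrite -ball_normE /ball_ /= norm_nrm ltcR ltNge => /negP.
  apply; rewrite -(ler_pM2r w0) -expr2 (nrm_sqr hsemi).
  rewrite -[X in ip X w](subrK u) (ipDl hsemi) (Dw u) // addr0.
  exact: le_trans (Re_le_normc _) (ip_CauchySchwarz hsemi _ _).
- by apply: ball_open.
by exists w; apply: ballxx; rewrite ltcR.
Qed.

(* With [S = (B - rho)^-1] for a real [rho] close to [0], the bounded operator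
   [L = (1 + rho S) / 2 = B S / 2] has the kernel of [B], and [0] is isolated
   in its spectrum. *)
Lemma isolated_point_range (B : operator H) (e : R) :
  linear_op B -> symmetric_op ip B -> 0 < e ->
  (forall r : R, 0 < `|r| -> `|r| < e -> resolvent_set ip B r%:C) ->
  exists2 K : R, 0 <= K &
    forall h, (forall k, ker_op B k -> ip h k = 0) ->
    exists x, [/\ dom B x, B x = h & nrm x <= K * nrm h].
Proof.
move=> [Bd Bl] Bs e0 hres.
have [r rE] : exists r, r = e / 2 by exists (e / 2).
have r0 : 0 < r by rewrite rE divr_gt0.
have [||S [[Sl [c Sc]] SB BS]] := hres r; rewrite ?gtr0_norm //.
  by rewrite rE; lra.
have {}Sc x : nrm (S x) <= c * nrm x by exact: Sc.
have SD x : dom B (S x) by have [] := SB x.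
have SE x : B (S x) = x + r%:C *: S x.
  by have [_ /= /eqP] := SB x; rewrite subr_eq => /eqP.
have Ss x y : ip (S x) y = ip x (S y).
  have Sr t : t = B (S t) - r%:C *: S t by rewrite SE addrK.
  have -> : ip (S x) y = ip (S x) (B (S y) - r%:C *: S y) by rewrite -Sr.
  have -> : ip x (S y) = ip (B (S x) - r%:C *: S x) (S y) by rewrite -Sr.
  by rewrite (ipBl hsemi) (ipBr hsemi) Bs // (ipZl hsemi) (ipZr hsemi)
    conjc_real.
pose c1 := Num.max c 0.
have c10 : 0 <= c1 by rewrite le_max lexx orbT.
have Sc1 x : nrm (S x) <= c1 * nrm x.
  by apply: le_trans (Sc _) _; rewrite ler_wpM2r ?nrm_ge0 // le_max lexx.
pose L x := (2^-1)%:C *: (x + r%:C *: S x).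
have LE x : L x = (2^-1)%:C *: B (S x) by rewrite SE.
have Ll : linear_on setT L.
  move=> a x y _ _; rewrite /L Sl // (scalerA a) (mulrC a) -(scalerA _ a).
  rewrite -scalerDr; congr (_ *: _).
  by rewrite !scalerDr !scalerA [a * _]mulrC addrACA.
have Ls x y : ip (L x) y = ip x (L y).
  rewrite /L (ipZl hsemi) (ipZr hsemi) (ipDl hsemi) (ipDr hsemi).
  by rewrite (ipZl hsemi) (ipZr hsemi) !conjc_real Ss.
have Lc x : nrm (L x) <= (1 + r * c1) * nrm x.
  rewrite /L (nrmZ hsemi) normcR gtr0_norm ?invr_gt0 //.
  apply: le_trans (_ : nrm (x + r%:C *: S x) <= _).
    by rewrite ler_piMl ?nrm_ge0 // invf_le1 // ler1n.
  apply: le_trans (nrmD hsemi _ _) _; rewrite mulrDl mul1r lerD2l.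
  by rewrite (nrmZ hsemi) normcR gtr0_norm // -mulrA ler_pM2l.
pose d : R := 4^-1; have d0 : 0 < d by rewrite invr_gt0.
have gap : forall x, d * nrm (L x) <= nrm (L (L x)).
  apply: (symmetric_gap hsemi Ll Ls Lc) => //.
    by rewrite addr_ge0 // mulr_ge0 // ltW.
  move=> s s0 sd.
  have sN : s < d by apply: le_lt_trans sd; exact: ler_norm.
  have s2 : 0 < 1 - 2 * s by move: sN; rewrite /d; lra.
  (* Formally [L = B / (2 (B - r))], and [r'] is the value [b] solving [b / (2 (b - r)) = s]. The
     choice [d = 1/4] keeps [r'] in the punctured interval where resolvents exist. *)
  pose r' := - (2 * s * r / (1 - 2 * s)).
  have r'E : `|r'| = 2 * `|s| * r / (1 - 2 * s).
    rewrite normrN normf_div (normrM _ r) (normrM 2) normr_nat.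
    by rewrite (gtr0_norm r0) (gtr0_norm s2).
  have r'0 : 0 < `|r'| by rewrite r'E divr_gt0 // !mulr_gt0.
  have r'e : `|r'| < e.
    rewrite r'E ltr_pdivrMr //.
    have -> : e = 2 * r by rewrite rE; field.
    move: sd sN; rewrite /d => *; nra.
  have [S' [[_ [c' Sc']] _ BS']] := hres r' r'0 r'e.
  have {}Sc' x : nrm (S' x) <= c' * nrm x by exact: Sc'.
  have key x : B (S x) - r'%:C *: S x = (2 / (1 - 2 * s))%:C *: (L x - s%:C *:
    x).
    pose a := 2 / (1 - 2 * s).
    have a1 : a * 2^-1 - a * s = 1 by rewrite /a; field; rewrite gt_eqF.
    have a2 : r - r' = a * 2^-1 * r by rewrite /a /r'; field; rewrite gt_eqF.
    rewrite SE -addrA -scalerBl -rmorphB a2 /L -/a scalerBr scalerA -rmorphM.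
    rewrite scalerDr !scalerA -!rmorphM addrAC -scalerBl -rmorphB a1.
    by rewrite scale1r.
  pose c2 := Num.max c' 0.
  have c20 : 0 <= c2 by rewrite le_max lexx orbT.
  have Sc2 x : nrm (S x) <= c2 * nrm (B (S x) - r'%:C *: S x).
    rewrite -{1}[S x](BS' _ (SD x)); apply: le_trans (Sc' _) _.
    by rewrite ler_wpM2r ?nrm_ge0 // le_max lexx.
  (* With [w = (B - r') S x], one has [x = w + (r' - r) S x] and [|S x| <= c2 |w|], while [w] is
     [2 / (1 - 2 s)] times [L x - s x]. *)
  pose k := (1 + `|r' - r| * c2) * (2 / (1 - 2 * s)).
  have k0 : 0 < k.
    by rewrite mulr_gt0 ?divr_gt0 // ltr_wpDr // mulr_ge0.
  exists k^-1 => [|x]; first by rewrite invr_gt0.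
  rewrite ler_pdivrMl // /k -mulrA.
  have -> : 2 / (1 - 2 * s) * nrm (L x - s%:C *: x) =
      nrm (B (S x) - r'%:C *: S x).
    by rewrite key (nrmZ hsemi) normcR gtr0_norm // divr_gt0.
  set w := B (S x) - _; rewrite mulrDl mul1r.
  have {1}-> : x = w + (r' - r)%:C *: S x.
    by rewrite /w SE rmorphB scalerBl addrA subrK addrK.
  apply: le_trans (nrmD hsemi _ _) _; rewrite lerD2l (nrmZ hsemi) normcR.
  by rewrite -mulrA ler_wpM2l // Sc2.
have LB x y : L (x - y) = L x - L y by rewrite (linear_onB (@subspace_setT _ H)
  Ll).
(* Projecting on the range of [L^2] rather than of [L] lets [gap] act: if [L^2 x_n] is Cauchy, so is
   [L x_n]. *)
pose M : set H := range (L \o L).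
have Msub : is_subspace M.
  split; first by exists 0 => //=;
    rewrite !(linear_on0 (@subspace_setT _ H) Ll).
  by move=> a _ _ [x _ <-] [y _ <-]; exists (a *: x + y) => //=; rewrite !Ll.
(* The solution will be [S z / 2] with [L z = h] and [d |z| <= |h|]; for [d = 1/4] its norm is at
   most [c1 / (2 d) = 2 c1] times [|h|]. *)
exists (2 * c1) => [|h hk]; first by rewrite mulr_ge0.
have /choice[x hx] : forall n : nat, exists y, forall b, M b ->
    normc (ip (h - L (L y)) b) <= n.+1%:R^-1 * nrm b.
  move=> n; have [|a [y _ <-] hy] := approx_projection hsemi h (e :=
    n.+1%:R^-1) Msub.
    by rewrite invr_gt0.
  by exists y.
have LLcauchy n m : nrm (L (L (x n)) - L (L (x m))) <= n.+1%:R^-1 + m.+1%:R^-1.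
  apply: (approx_projection_close hsemi Msub _ _ (hx n) (hx m)) => //.
  - by exists (x n).
  - by exists (x m).
have [y hy] := @complete_sequence (fun n => L (L (x n))) 1 ler01
  (fun n m => ltac:(by rewrite mul1r)).
have d40 : 0 <= d^-1 by rewrite invr_ge0 ltW.
have [n m|z hz] := @complete_sequence (fun n => L (x n)) d^-1 d40.
  rewrite ler_pdivlMl // -LB; apply: le_trans (gap _) _.
  by rewrite !LB.
(* [h - y] is orthogonal to the range of [L^2]; testing against [L^2 (h - y)] gives
   [|L (h - y)|^2 = 0]. *)
have Lp : L (h - y) = 0.
  apply: ip_eq0; rewrite Ls; set b := L (L (h - y)).
  have Mb : M b by exists (h - y).
  apply: eq0_normc; apply/le_anti; rewrite normc_ge0 andbT.
  apply: (@harmonic_le0 _ (2 * nrm b)) => n.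
  have -> : h - y = (h - L (L (x n))) + (L (L (x n)) - y) by rewrite addrA
    subrK.
  rewrite (ipDl hsemi); apply: le_trans (le_normcD _ _) _.
  have := hx n b Mb; have := ip_CauchySchwarz hsemi (L (L (x n)) - y) b.
  have := ler_wpM2r (nrm_ge0 ip b) (hy n).
  rewrite mul1r -mulrA [nrm b * _]mulrC.
  set t := _^-1 * nrm b; set t1 := _ * nrm b; lra.
have pker : ker_op B (h - y).
  have -> : h - y = (- r)%:C *: S (h - y).
    have /eqP : L (h - y) = 0 by [].
    rewrite /L scaler_eq0 => /orP[/eqP[/eqP]|];
      first by rewrite invr_eq0 pnatr_eq0.
    by rewrite addr_eq0 rmorphN scaleNr => /eqP.
  split; first exact: (subspaceZ Bd).
  rewrite (linear_onZ Bd Bl) // -[B _](scalerK (_ : (2^-1 : R)%:C != 0)).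
    by rewrite -LE Lp !scaler0.
  by apply/eqP => -[/eqP]; rewrite invr_eq0 pnatr_eq0.
(* [y] is a limit of vectors [L^2 x_n], all orthogonal to the kernel of [L]; with the hypothesis on
   [h], the kernel vector [h - y] is orthogonal to itself. *)
have yp : ip y (h - y) = 0.
  by apply: limit_orthogonal hy _ => n /=; rewrite Ls Lp (ip0r hsemi).
have hE : h = y.
  apply/eqP; rewrite -subr_eq0; apply/eqP/ip_eq0.
  by rewrite (ipBl hsemi) yp subr0; exact: hk.
have Lz : L z = h.
  apply/eqP; rewrite -subr_eq0; apply/eqP/nrm_le0.
  apply: (@harmonic_le0 _ ((1 + r * c1) * d^-1 + 1)) => n.
  apply: le_trans (nrm_dist hsemi _ (L (L (x n))) _) _.
  rewrite mulrDl lerD // ?hE //.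
    rewrite -LB; apply: le_trans (Lc _) _.
    rewrite (nrmBC hsemi) -mulrA ler_wpM2l //.
    by rewrite addr_ge0 // mulr_ge0 // ltW.
have nz : d * nrm z <= nrm h.
  rewrite -subr_le0; apply: (@harmonic_le0 _ 2) => n.
  have h1 := gap (x n).
  have h2 := nrm_dist hsemi (L (L (x n))) y 0.
  have h3 := nrm_dist hsemi z (L (x n)) 0.
  have := hz n; have := hy n; move: h1 h2 h3.
  rewrite !subr0 -hE (nrmBC hsemi z) mul1r.
  rewrite [d^-1 * _]mulrC => h1 h2 h3 h4; rewrite ler_pdivlMr // => h5.
  move: h3; rewrite -(ler_pM2l d0) mulrDr => h3.
  set t := n.+1%:R^-1 in h4 h5 *; lra.
exists ((2^-1)%:C *: S z); split.
- exact: (subspaceZ Bd).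
- by rewrite (linear_onZ Bd Bl) // -LE.
rewrite (nrmZ hsemi) normcR gtr0_norm ?invr_gt0 // ler_pdivrMl //.
apply: le_trans (Sc1 z) _; move: nz; rewrite ler_pdivrMl // => nz.
have := ler_wpM2l c10 nz; move: (nrm z) (nrm h) => a b ab.
lra.
Qed.

End HilbertSpace.

(** * Boundary triplets *)

Section FiniteCodimension.
Set Implicit Arguments.
Unset Strict Implicit.
Import ComplexField.Normc.

(** The rows of a free family of maximal size in [W] span [W]; if they do not span everything, a
    nonzero column of the cokernel matrix annihilates [W]. This is the duality that later makes the
    coordinates of the range along a finite-dimensional kernel exhaust all vectors. *)
Lemma subspace_rV_or_annihilator (F : fieldType) m (W : 'rV[F]_m -> Prop) :
  W 0 -> (forall a x y, W x -> W y -> W (a *: x + y)) ->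
  (forall x, W x) \/
  exists2 c : 'cV[F]_m, c != 0 & forall x, W x -> x *m c = 0.
Proof.
move=> W0 Wl.
pose P r := exists X : 'M[F]_(r, m), row_free X /\ forall i, W (row i X).
have P0 : P 0%N by exists 0; split; [rewrite /row_free mxrank0|case].
have Pm r : P r -> (r <= m)%N.
  by move=> [X [Xfree _]]; rewrite -(eqP Xfree) rank_leq_col.
have [r [Pr rmax]] : exists r, P r /\ forall r', P r' -> (r' <= r)%N.
  have ex : exists r, `[< P r >] by exists 0%N; apply/asboolP.
  have ub r : `[< P r >] -> (r <= m)%N by move=> /asboolP/Pm.
  case: (ex_maxnP ex ub) => r /asboolP Pr rmax; exists r; split=> // r' Pr'.
  exact/rmax/asboolP.
have [X [Xfree XW]] := Pr.
(* A vector of [W] outside the row space could be appended to [X], against maximality. *)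
have sub x : W x -> (x <= X)%MS.
  move=> Wx; apply: contraT => xX.
  suff : P r.+1 by move/rmax; rewrite ltnn.
  rewrite -[r.+1]/(1 + r)%N; exists (col_mx x X); split; last first.
    move=> i; case: (split_ordP i) => j ->; last by rewrite rowKd.
    by rewrite rowKu row_id.
  rewrite /row_free eqn_leq rank_leq_row -addsmxE.
  apply: leq_ltn_trans (_ : \rank X < _)%N; first by rewrite (eqP Xfree).
  apply: rank_ltmx.
  by rewrite ltmxE addsmxSr addsmx_sub (negPf xX).
have [Xfull|Xnfull] := boolP (row_full X).
  left=> x; have /submxP[D ->] := submx_full x Xfull.
  rewrite mulmx_sum_row; elim/big_ind: _ => // [y z Wy Wz|i _].
    by rewrite -[y]scale1r; exact: Wl.
  by rewrite -[_ *: _]addr0; exact: Wl.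
right; have /matrix0Pn[i [j ij]] : cokermx X != 0 by rewrite cokermx_eq0.
exists (col j (cokermx X)) => [|x /sub xX].
  by apply/eqP => /colP/(_ i)/eqP; rewrite mxE [X in _ == X]mxE (negPf ij).
by move: xX; rewrite submxE colE mulmxA => /eqP ->; rewrite mul0mx.
Qed.

End FiniteCodimension.

Section BoundaryTripletOperator.
Set Implicit Arguments.
Unset Strict Implicit.
Import ComplexField.Normc.
Context {R : realType}.
Notation C := R[i].
Variables (H : completeNormedModType C) (ip : {dot H for Num.conj}).
Hypothesis hip : induces_norm ip.
Local Notation nrm := (ip_norm ip).
Let hsemi := dot_semi_inner ip.

(** * The adjoint of a densely defined operator *)

Variable A : operator H.
Hypotheses (Alin : linear_op A) (Adense : densely_defined A).
Local Notation As := (adjoint ip A).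

Lemma adjointP u v : dom A u -> dom As v -> ip (A u) v = ip u (As v).
Proof.
by move=> Au Av; exact: (xgetPex 0 Av u Au).
Qed.

(** Density makes the value selected by [xget] the only possible one, so an adjoint can be computed
    by exhibiting a candidate. *)
Lemma adjoint_unique v w : (forall u, dom A u -> ip (A u) v = ip u w) ->
  dom As v /\ As v = w.
Proof.
move=> hw; have Asv : dom As v by exists w.
split=> //; apply/eqP; rewrite -subr_eq0; apply/eqP.
apply: (dense_orthogonal hip Adense) => u Au.
by rewrite (ipBr hsemi) -adjointP // hw // subrr.
Qed.

Lemma adjoint_linear : linear_op As.
Proof.
have key a x y : dom As x -> dom As y ->
    dom As (a *: x + y) /\ As (a *: x + y) = a *: As x + As y.
  move=> Ax Ay; apply: adjoint_unique => u Au.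
  by rewrite !(ipDr hsemi) !(ipZr hsemi) !adjointP.
split; last by move=> a x y Ax Ay; have [] := key a x y Ax Ay.
split=> [|a x y Ax Ay]; last by have [] := key a x y Ax Ay.
by have [] // := @adjoint_unique 0 0; move=> u _; rewrite !(ip0r hsemi).
Qed.

(* The approximate projections of [(k, As k)] onto the graph of [A] converge;
   their limit [(x, A x)] leaves a residue [(- As g, g)], and the hypothesis on
   [k] applied to [g] annihilates it. *)
Lemma double_adjoint_sub k : closed_op A -> symmetric_op ip A -> dom As k ->
  (forall z, dom As z -> ip (As z) k = ip z (As k)) -> dom A k.
Proof.
move=> Ac Asym Ask hk.
have [Ad Al] := Alin.
have AAs u : dom A u -> dom As u /\ As u = A u.
  by move=> Au; apply: adjoint_unique => v Av; exact: Asym.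
pose ipp := ip_sum ip ip; have hpp := ip_sum_semi_inner hsemi hsemi.
pose M : set (H * H) := [set p | dom A p.1 /\ p.2 = A p.1].
have Msub : is_subspace M.
  split; first by split; [exact: Ad.1|rewrite /= (linear_on0 Ad Al)].
  move=> a [x x'] [y y'] [/= Ax ->] [/= Ay ->]; split; first exact: Ad.2.
  by rewrite /= Al.
pose h : H * H := (k, As k).
have /choice[a ha] : forall n : nat, exists a, dom A a /\
    forall b, M b -> normc (ipp (h - (a, A a)) b) <= n.+1%:R^-1 * ip_norm ipp b.
  move=> n; have [|[a a'] [/= Aa ->] hb] := approx_projection hpp h (e :=
    n.+1%:R^-1) Msub.
    by rewrite invr_gt0.
  by exists a.
have hcauchy n m : ip_norm ipp ((a n, A (a n)) - (a m, A (a m))) <=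
    1 * (n.+1%:R^-1 + m.+1%:R^-1).
  rewrite mul1r.
  apply: (approx_projection_close hpp Msub _ _ (ha n).2 (ha m).2) => //.
  - by split; [exact: (ha n).1|].
  - by split; [exact: (ha m).1|].
have [n m|x hx] := @complete_sequence _ _ _ hip a 1 ler01.
  exact: le_trans (nrm_fst_le _ hsemi hsemi) (hcauchy n m).
have [n m|y hy] := @complete_sequence _ _ _ hip (A \o a) 1 ler01.
  exact: le_trans (nrm_snd_le _ hsemi hsemi) (hcauchy n m).
have [Ax yE] : dom A x /\ y = A x.
  have aM n : M (a n, A (a n)) by split=> //; exact: (ha n).1.
  suff [] : M (x, y) by [].
  apply: (@closed_cvg _ _ \oo _ (fun n => (a n, A (a n))) M Ac).
    exact: nearW.
  by apply: cvg_pair; [exact: (nrm_limit_cvg hip hx)|exact: (nrm_limit_cvg hip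
    hy)].
(* In the limit, the approximate orthogonality becomes exact: [(k - x, As k - y)] is orthogonal to
   the graph of [A]. *)
have res b : dom A b -> ip (k - x) b + ip (As k - y) (A b) = 0.
  move=> Ab; have Mb : M (b, A b) by [].
  apply: eq0_normc; apply/le_anti; rewrite normc_ge0 andbT.
  apply: (@harmonic_le0 _ _ (ip_norm ipp (b, A b) + nrm b + nrm (A b))) => n.
  have h1 := (ha n).2 _ Mb.
  have h2 := ip_CauchySchwarz hsemi (a n - x) b.
  have h3 := ip_CauchySchwarz hsemi (A (a n) - y) (A b).
  have h4 := ler_wpM2r (nrm_ge0 ip b) (hx n).
  have h5 := ler_wpM2r (nrm_ge0 ip (A b)) (hy n).
  have -> : ip (k - x) b + ip (As k - y) (A b) =
      ipp (h - (a n, A (a n))) (b, A b) + ip (a n - x) b + ip (A (a n) - y) (A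
        b).
    rewrite /ipp /ip_sum /= !(ipBl hsemi); ring.
  apply: le_trans (le_normcD _ _) _;
    apply: le_trans (lerD (le_normcD _ _) (lexx _)) _.
  rewrite [leRHS]mulrC !mulrDr; move: h1 h2 h3 h4 h5; rewrite /= !mul1r.
  set t := n.+1%:R^-1; set t1 := t * _; set t2 := t * nrm b; set t3 := t * _.
  set t4 := _ * nrm b; set t5 := _ * nrm (A b); lra.
pose g := As k - A x.
have [Asg AsgE] : dom As g /\ As g = x - k.
  apply: adjoint_unique => b Ab; rewrite /g -yE.
  have := res b Ab; rewrite addrC => /eqP; rewrite addr_eq0 => /eqP e.
  by rewrite (ipC hsemi) e -(ipNl hsemi) -(ipC hsemi) opprB.
have [Asx AsxE] := AAs _ Ax.
(* Applying [hk] at [z = g] moves [As] across, so [|g|^2 = <As g, k - x>]; since [As g = x - k], the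
   two squares cancel. *)
have e : ip (k - x) (k - x) + ip g g = 0.
  have -> : ip g g = ip (As g) (k - x).
    have e1 : ip (As g) x = ip g (A x).
      by rewrite (ipC hsemi) -(adjointP Ax Asg) -(ipC hsemi).
    by rewrite (ipBr hsemi (As g)) hk // e1 -(ipBr hsemi).
  by rewrite AsgE -(ipDl hsemi) addrA subrK subrr (ip0l hsemi).
have [_ _ pos] := hsemi.
move/eqP: e; rewrite paddr_eq0 // => /andP[/eqP/(ip_eq0 hip)/eqP + _].
by rewrite subr_eq0 => /eqP ->.
Qed.

(** Adjunction reverses inclusions: [cA] is its own adjoint, hence contained in that of [A]. *)
Lemma extension_adjoint cA : self_adjoint ip cA -> extends A cA ->
  forall u, dom cA u -> dom As u /\ As u = cA u.
Proof.
move=> [_ cAd cAdom cAE] [AcA AcAE] u cAu; apply: adjoint_unique => v Av.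
rewrite -(AcAE v Av) cAE //; last exact: AcA.
have cAu' : dom (adjoint ip cA) u by rewrite -cAdom.
have := xgetPex 0 cAu' v (AcA v Av); rewrite -[xget _ _]/(adjoint ip cA u).
by rewrite -!cAE //; exact: AcA.
Qed.

Lemma self_adjoint_symmetric cA : self_adjoint ip cA -> symmetric_op ip cA.
Proof.
move=> [_ _ cAdom cAE] u v cAu cAv.
have cAv' : dom (adjoint ip cA) v by rewrite -cAdom.
by have := xgetPex 0 cAv' u cAu; rewrite -[xget _ _]/(adjoint ip cA v) -cAE.
Qed.

(** * The symplectic form on the boundary space *)

Variables (G : completeNormedModType C) (ipG : {dot G for Num.conj}).
Let hG := dot_semi_inner ipG.
Let hG2 : semi_inner_product (ip2 ipG) := ip_sum_semi_inner hG hG.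

Lemma omegaE f g : omega ipG f g = ipG f.2 g.1 - ipG f.1 g.2.
Proof. by rewrite /omega /ip2 /ip_sum /= (ipNl hG). Qed.

Lemma omega_le f g :
  normc (omega ipG f g) <= ip_norm (ip2 ipG) f * ip_norm (ip2 ipG) g.
Proof.
apply: le_trans (ip_CauchySchwarz hG2 _ _) _.
rewrite /ip_norm /ip2 /ip_sum /= (ipNl hG) (ipNr hG) opprK.
by rewrite [X in complex.Re X]addrC.
Qed.

(** Testing with [f = (- g.2, g.1)] yields [|g.1|^2 + |g.2|^2 = 0]. *)
Lemma omega_nondegenerate g : induces_norm ipG ->
  (forall f, omega ipG f g = 0) -> g = 0.
Proof.
move=> hipG /(_ (- g.2, g.1)); rewrite omegaE /= (ipNl hG) opprK.
have [_ _ pos] := hG.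
move/eqP; rewrite paddr_eq0 // => /andP[/eqP/(ip_eq0 hipG) g1 /eqP/(ip_eq0
  hipG) g2].
by case: g g1 g2 => a b /= -> ->.
Qed.

Lemma nrm_graph_le u : ip_norm (ip_graph ip As) u <= nrm u + nrm (As u).
Proof.
rewrite [leLHS]/ip_norm /ip_graph; move: (As u) => w.
rewrite raddfD /= -!(nrm_sqr hsemi).
rewrite -(@ler_pXn2r _ 2) ?nnegrE ?sqrtr_ge0 ?addr_ge0 ?nrm_ge0 //.
rewrite sqr_sqrtr ?addr_ge0 ?sqr_ge0 // sqrrD lerD2r lerDl.
by rewrite mulrn_wge0 // mulr_ge0 ?nrm_ge0.
Qed.

(** * Green's identity and solvability for the shifted adjoint *)

Variables (T : H -> G * G) (V : H -> H) (l : R).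
Hypotheses (hT : boundary_triplet ip ipG A T) (hV : bounded_self_adjoint ip V).
Local Notation D := (op_shift (op_add As V) l%:C).

(** The symmetric [V] and the real shift [l] cancel from the two sides, so Green's identity holds
    for [D] as it does for [As]. *)
Lemma triplet_green u v : dom As u -> dom As v ->
  ip (D u) v - ip u (D v) = omega ipG (T u) (T v).
Proof.
move=> Au Av; case: hT => _ _ green; case: hV => _ Vs.
rewrite omegaE -green //= !(ipBl hsemi) !(ipBr hsemi) (ipDl hsemi) (ipDr hsemi).
by rewrite (ipZl hsemi) (ipZr hsemi) conjc_real Vs; ring.
Qed.

Lemma bounded_ge0 (E F : lmodType C) (X : set E) (ipE : E -> E -> C)
    (ipF : F -> F -> C) L : bounded_op X ipE ipF L ->
  exists2 c : R, 0 <= c & opnorm_le X ipE ipF L c.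
Proof.
move=> [_ [c hc]]; exists (Num.max c 0); first by rewrite le_max lexx orbT.
move=> x Xx; apply: le_trans (hc x Xx) _.
by rewrite ler_wpM2r ?nrm_ge0 // le_max lexx.
Qed.

(** When the trace of [k] vanishes, Green's identity has no boundary term and puts [k] in the domain
    of the double adjoint. *)
Lemma triplet_kernel k : closed_op A -> symmetric_op ip A -> dom As k ->
  T k = 0 -> dom A k.
Proof.
move=> Ac Asym Ask Tk; apply: double_adjoint_sub => // z Asz.
case: hT => _ _ /(_ z k Asz Ask); rewrite Tk !(ip0r hG) subr0.
by move/eqP; rewrite subr_eq0 => /eqP.
Qed.

(** As [D k = 0], Green's identity leaves [omega (T z, T k) = 0] for all [z]. Surjectivity of [T]
    and nondegeneracy give [T k = 0], so [k] lies in [dom A], where [hker] leaves only 0. *)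
Lemma orthogonal_range_kernel k : induces_norm ipG -> closed_op A ->
  symmetric_op ip A -> ker_adj ip A V l%:C `&` dom A = [set 0] ->
  ker_adj ip A V l%:C k -> (forall z, dom As z -> ip (D z) k = 0) -> k = 0.
Proof.
move=> hipG Ac Asym hker kk hk; have [Ask Dk] := kk.
have : (ker_adj ip A V l%:C `&` dom A) k; last by rewrite hker.
split=> //; apply: triplet_kernel => //; apply: (omega_nondegenerate hipG) => f.
have [_ /(_ f)[z Asz <-] _] := hT.
by rewrite -triplet_green // hk // sub0r [D k]Dk (ip0r hsemi) oppr0.
Qed.

Lemma shifted_linear X : linear_op X ->
  linear_op (op_shift (op_add X V) l%:C).
Proof.
move=> [Xd Xl]; have [[Vl _] _] := hV; split=> // a x y Xx Xy /=.
rewrite Xl // Vl // scalerBr !scalerDr !scalerA [a * _]mulrC opprD.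
by rewrite [X in X + _ = _]addrACA [LHS]addrACA.
Qed.

Lemma shifted_extension cA : self_adjoint ip cA ->
  linear_op (op_shift (op_add cA V) l%:C) /\
  symmetric_op ip (op_shift (op_add cA V) l%:C).
Proof.
move=> cAsa; have [cAlin _ _ _] := cAsa; have [_ Vs] := hV.
split; last first.
  move=> u v cAu cAv /=; rewrite !(ipBl hsemi) !(ipBr hsemi) (ipDl hsemi).
  rewrite (ipDr hsemi) (ipZl hsemi) (ipZr hsemi) conjc_real Vs.
  by rewrite (self_adjoint_symmetric cAsa).
exact: shifted_linear.
Qed.

(* The range of [As + V - l] contains the range of its self-adjoint restriction,
   which is the orthogonal complement of a finite-dimensional kernel, and no
   nonzero vector of that kernel is orthogonal to it. *)
Lemma triplet_surjective cA (e : R) m (u : 'I_m -> H) : induces_norm ipG ->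
  closed_op A -> symmetric_op ip A ->
  ker_adj ip A V l%:C `&` dom A = [set 0] ->
  self_adjoint ip cA -> extends A cA -> 0 < e ->
  (forall z, `|z - l%:C| < e%:C -> spectrum ip (op_add cA V) z -> z = l%:C) ->
  fin_orthonormal_basis ip (ker_op (op_shift (op_add cA V) l%:C)) u ->
  exists2 K : R, 0 <= K &
    forall h, exists v, [/\ dom As v, D v = h & nrm v <= K * nrm h].
Proof.
move=> hipG Ac Asym hker cAsa AcA e0 hspec [uk uo ub].
have [Bl Bs] := shifted_extension cAsa.
set B := op_shift (op_add cA V) l%:C in Bl Bs uk ub.
have cAAs := extension_adjoint cAsa AcA.
have BD x : dom cA x -> dom As x /\ D x = B x.
  move=> /cAAs[Asx E]; split=> //.
  exact: (congr1 (fun y => y + V x - l%:C *: x) E).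
have [|K K0 hK] := isolated_point_range hip Bl Bs e0.
  move=> r r0 re; apply: contrapT => hr.
  have /hspec : `|(l + r)%:C - l%:C| < e%:C.
    by rewrite rmorphD /= addrAC subrr add0r normC_norm normcR ltcR.
  have shiftE x : op_shift B r%:C x = op_shift (op_add cA V) (l + r)%:C x.
    by rewrite /= rmorphD scalerDl opprD addrA.
  have hs : spectrum ip (op_add cA V) (l + r)%:C.
    move=> [S [S1 S2 S3]]; apply: hr; exists S; split=> // x.
      by rewrite shiftE; exact: S2.
    by rewrite shiftE; exact: S3.
  move=> /(_ hs) -[lr]; have r00 : r = 0 by lra.
  by move: r0; rewrite r00 normr0 ltxx.
have [Dd Dl] : linear_op D by apply/shifted_linear/adjoint_linear.
have ukD j : ker_adj ip A V l%:C (u j).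
  have [cAu Bu] := uk j; have [Asu E] := BD _ cAu.
  by split=> //; exact: etrans E Bu.
have hperp h : (forall j, ip h (u j) = 0) ->
    exists v, [/\ dom As v, D v = h & nrm v <= K * nrm h].
  move=> hu; have [|x [cAx Bx xh]] := hK h.
    move=> k /ub[c ->]; rewrite (ipC hsemi) (ip_suml hsemi) big1 ?conjc0 //.
    by move=> j _; rewrite (ipZl hsemi) (ipC hsemi) hu conjc0 mulr0.
  by have [Asx DE] := BD x cAx; exists x; rewrite DE.
(* [W] collects the coordinates, along the kernel basis [u], of the vectors in the range of [D]. *)
pose W (w : 'rV[C]_m) := exists2 z, dom As z & forall j, w 0 j = ip (D z) (u j).
have Wall w : W w.
  have [||//|[c c0 hc]] := @subspace_rV_or_annihilator _ m W.
  - exists 0; first exact: Dd.1.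
    by move=> j; rewrite (linear_on0 Dd Dl) (ip0l hsemi) mxE.
  - move=> a x y [x' Ax hx] [y' Ay hy]; exists (a *: x' + y');
    first exact: Dd.2.
    by move=> j; rewrite !mxE Dl // (ipDl hsemi) (ipZl hsemi) hx hy.
  (* Conjugating the annihilator compensates the antilinearity in the second argument: [<D z, k>] is
     the sum of [c_j <D z, u_j>], hence 0. *)
  pose k := \sum_j (conjc (c j 0)) *: u j.
  have k0 : k = 0.
    apply: orthogonal_range_kernel => //.
      split; first by apply: (subspace_sum Dd) => j;
        apply: (subspaceZ Dd) => //; have [] := ukD j.
      rewrite (linear_on_sum Dd Dl) => [|j]; last first.
        by apply: (subspaceZ Dd) => //; have [] := ukD j.
      rewrite big1 // => j _; have [uj Duj] := ukD j.
      by rewrite (linear_onZ Dd Dl) // [D _]Duj scaler0.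
    move=> z Asz; rewrite (ipC hsemi) (ip_suml hsemi).
    have Wz : W (\row_j ip (D z) (u j)) by exists z => // j; rewrite mxE.
    have /matrixP/(_ 0 0) := hc _ Wz; rewrite !mxE => cz.
    rewrite -[RHS]cz rmorph_sum; apply: eq_bigr => j _.
    by rewrite mxE [LHS]/= -(ipC hsemi) (ipZr hsemi) conjcK mulrC.
  case/eqP: c0; apply/colP => i; rewrite mxE.
  have := congr1 (ip^~ (u i)) k0; rewrite (ip0l hsemi) (ip_suml hsemi).
  rewrite (bigD1 i) //= big1 => [|j ji]; last first.
    by rewrite (ipZl hsemi) uo (negPf ji) mulr0.
  by rewrite addr0 (ipZl hsemi) uo eqxx mulr1 => /eqP;
    rewrite conjc_eq0 => /eqP.
(* A [z] for which [D z] has the coordinates of [u j] leaves a remainder [D z - u j] orthogonal to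
   the kernel, which [hperp] solves away. *)
have /choice[v hv] : forall j, exists v, dom As v /\ D v = u j.
  move=> j; have [z Asz hz] := Wall (delta_mx 0 j).
  have [i|x [Asx Dx _]] := hperp (D z - u j).
    by rewrite (ipBl hsemi) -hz uo mxE eqxx eq_sym subrr.
  exists (z - x); split; first exact: (subspaceB Dd).
  by rewrite (linear_onB Dd Dl) // Dx subKr.
pose s1 := \sum_j nrm (u j) * nrm (u j);
  pose s2 := \sum_j nrm (u j) * nrm (v j).
have s10 : 0 <= s1 by apply: sumr_ge0 => j _; rewrite mulr_ge0 ?nrm_ge0.
have s20 : 0 <= s2 by apply: sumr_ge0 => j _; rewrite mulr_ge0 ?nrm_ge0.
(* [1 + s1] bounds [h] minus its kernel component, and [s2] the combination of the [v j] solving for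
   that component. *)
exists (K * (1 + s1) + s2) => [|h];
  first by rewrite addr_ge0 ?mulr_ge0 ?addr_ge0.
have sum_le (w : 'I_m -> H) :
    nrm (\sum_j ip h (u j) *: w j) <= nrm h * \sum_j nrm (u j) * nrm (w j).
  apply: le_trans (nrm_sum hsemi _ _) _; rewrite mulr_sumr;
    apply: ler_sum => j _.
  rewrite (nrmZ hsemi) mulrA ler_wpM2r ?nrm_ge0 //.
  exact: (ip_CauchySchwarz hsemi).
have [i|x [Asx Dx xh]] := hperp (h - \sum_j ip h (u j) *: u j).
  rewrite (ipBl hsemi) (ip_suml hsemi) (bigD1 i) //= big1 => [|j ji].
    by rewrite addr0 (ipZl hsemi) uo eqxx mulr1 subrr.
  by rewrite (ipZl hsemi) uo (negPf ji) mulr0.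
have Asv j : dom As (ip h (u j) *: v j) by apply: (subspaceZ Dd);
  have [] := hv j.
have Assum : dom As (\sum_j ip h (u j) *: v j) by exact: (subspace_sum Dd).
exists (x + \sum_j ip h (u j) *: v j); split; first exact: (subspaceD Dd).
  rewrite (linear_onD Dl) // Dx (linear_on_sum Dd Dl) //.
  rewrite [X in _ + X](eq_bigr (fun j => ip h (u j) *: u j)) ?subrK // => j _.
  by have [vj Dvj] := hv j; rewrite (linear_onZ Dd Dl) // Dvj.
apply: le_trans (nrmD hsemi _ _) _; rewrite mulrDl lerD //; last first.
  by rewrite mulrC; exact: sum_le.
apply: le_trans xh _; rewrite -mulrA ler_wpM2l //.
apply: le_trans (nrmB hsemi _ _) _; rewrite mulrDl mul1r lerD2l mulrC.
exact: sum_le.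
Qed.

(** For [v] with [D v = z] and [|v| <= K |z|], Green's identity reads
    [|z|^2 = <D z, v> - omega (T z, T v)]. Both terms carry a factor [|z|], which is divided out. *)
Lemma triplet_a_priori (K : R) : 0 <= K ->
  (forall h, exists v, [/\ dom As v, D v = h & nrm v <= K * nrm h]) ->
  exists2 K' : R, 0 <= K' &
    forall z, dom As z -> nrm z <= K' * (nrm (D z) + ip_norm (ip2 ipG) (T z)).
Proof.
move=> K0 hK; have [Tb _ _] := hT; have [c c0 hc] := bounded_ge0 Tb.
have [cV cV0 hcV] := bounded_ge0 hV.1.
(* [g |z|] bounds [|v| + |As v|], hence the graph norm of [v], through [As v = z - V v + l v]. *)
pose g := K + (1 + cV * K + `|l| * K).
have g0 : 0 <= g by rewrite !addr_ge0 ?mulr_ge0.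
exists (K + c * g) => [|z Asz]; first by rewrite addr_ge0 ?mulr_ge0.
have [v [Asv Dv vz]] := hK z.
have nAsv : nrm (As v) <= (1 + cV * K + `|l| * K) * nrm z.
  have -> : As v = z - V v + l%:C *: v.
    by rewrite -{1}Dv addrAC [D v]/= subrK addrK.
  apply: le_trans (nrmD hsemi _ _) _; rewrite !mulrDl mul1r lerD //.
    apply: le_trans (nrmB hsemi _ _) _; rewrite lerD2l -mulrA.
    by apply: le_trans (hcV v I) _; rewrite ler_wpM2l.
  by rewrite (nrmZ hsemi) normcR -mulrA ler_wpM2l.
have Tv : ip_norm (ip2 ipG) (T v) <= c * g * nrm z.
  apply: le_trans (hc v Asv) _; rewrite -mulrA ler_wpM2l //.
  apply: le_trans (nrm_graph_le _) _; rewrite /g mulrDl lerD //.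
have [->|nz] := eqVneq (nrm z) 0.
  by rewrite mulr_ge0 ?addr_ge0 ?mulr_ge0 ?nrm_ge0.
have nz0 : 0 < nrm z by rewrite lt_neqAle eq_sym nz nrm_ge0.
rewrite -(ler_pM2r nz0) -expr2 (nrm_sqr hsemi).
have -> : ip z z = ip (D z) v - omega ipG (T z) (T v).
  by rewrite -triplet_green // Dv subKr.
apply: le_trans (Re_le_normc _) _; apply: le_trans (le_normcD _ _) _.
rewrite normcN mulrDr mulrDl; apply: lerD.
  apply: le_trans (ip_CauchySchwarz hsemi _ _) _.
  rewrite mulrAC [leRHS]mulrC ler_wpM2l ?nrm_ge0 //.
  apply: le_trans vz _; rewrite ler_wpM2r ?nrm_ge0 // lerDl mulr_ge0 //.
apply: le_trans (omega_le _ _) _.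
rewrite mulrAC [leRHS]mulrC ler_wpM2l ?nrm_ge0 //.
apply: le_trans Tv _; rewrite ler_wpM2r ?nrm_ge0 // lerDr //.
Qed.

End BoundaryTripletOperator.

(** * Convergence in norm *)

Section NormConvergence.
Set Implicit Arguments.
Unset Strict Implicit.
Import ComplexField.Normc.
Context {R : realType}.
Notation C := R[i].

Section Converges.
Context (F : set_system R) {FF : Filter F}.

(* Stated with [ip_norm], so that products carry their Hilbert norm. *)
Definition converges (E : lmodType C) (ip : E -> E -> C) (f : R -> E) (a : E) :=
  forall e : R, 0 < e -> \forall s \near F, ip_norm ip (f s - a) <= e.

Lemma converges_cst (E : lmodType C) (ip : E -> E -> C) a :
  semi_inner_product ip -> converges ip (fun=> a) a.
Proof.
move=> hip e e0; apply: filterE => s.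
by rewrite subrr (nrm0 hip) ltW.
Qed.

Lemma cvg_normc (f : R -> C) (a : C) :
  (forall e : R, 0 < e -> \forall s \near F, normc (f s - a) <= e) ->
  (f s : C^o) @[s --> F] --> (a : C^o).
Proof.
move=> h; apply/cvgrPdist_le => e /gt0_complex[r r0 ->].
apply: filterS (h r r0) => s.
by rewrite -normcN opprB normC_norm lecR.
Qed.

Lemma converges_ip (E : lmodType C) (ip : E -> E -> C) f g a b :
  semi_inner_product ip -> converges ip f a -> converges ip g b ->
  (ip (f s) (g s) : C^o) @[s --> F] --> (ip a b : C^o).
Proof.
move=> hip fa gb; apply: cvg_normc => e e0.
pose c := ip_norm ip a + (ip_norm ip b + 1).
have c0 : 0 < c by rewrite /c addrA ltr_wpDl ?addr_ge0 ?nrm_ge0.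
have d0 : 0 < Num.min 1 (e / c) by rewrite lt_min ltr01 divr_gt0.
apply: filterS2 (fa _ d0) (gb _ d0) => s; rewrite !le_min.
move=> /andP[_ fs] /andP[gs1 gs].
have -> : ip (f s) (g s) - ip a b = ip (f s - a) (g s) + ip a (g s - b).
  by rewrite (ipBl hip) (ipBr hip) addrA subrK.
apply: le_trans (le_normcD _ _) _.
apply: le_trans (lerD (ip_CauchySchwarz hip _ _) (ip_CauchySchwarz hip _ _)) _.
have gn : ip_norm ip (g s) <= ip_norm ip b + 1.
  by have := nrmD hip (g s - b) b; rewrite subrK; lra.
have -> : e = (e / c) * (ip_norm ip b + 1) + ip_norm ip a * (e / c).
  by rewrite [ip_norm ip a * _]mulrC -mulrDr [_ + 1 + _]addrC divfK ?gt_eqF.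
by apply: lerD; [apply: ler_pM|apply: ler_wpM2l]; rewrite ?nrm_ge0.
Qed.

Lemma converges_omega (G : lmodType C) (ipG : G -> G -> C) f g a b :
  semi_inner_product ipG -> converges (ip2 ipG) f a -> converges (ip2 ipG) g b
    ->
  (omega ipG (f s) (g s) : C^o) @[s --> F] --> (omega ipG a b : C^o).
Proof.
move=> hG fa gb; have hG2 := ip_sum_semi_inner hG hG.
apply: (converges_ip hG2 _ gb) => e e0; apply: filterS (fa e e0) => s.
rewrite /ip_norm /ip2 /ip_sum /= -opprD !(ipNl hG) !(ipNr hG) opprK.
by rewrite [X in _ -> Num.sqrt (complex.Re X) <= _]addrC.
Qed.

End Converges.

Lemma C1_difference_quotient (E E' : lmodType C) (D : set E) (ip : E -> E -> C)
    (ip' : E' -> E' -> C) (J : set R) L dL (t : R) x :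
  semi_inner_product ip' -> C1_on D ip ip' J L dL -> J t -> D x ->
  converges (within J t^') ip' (fun s => ((s - t)^-1)%:C *: (L s x - L t x))
    (dL t x).
Proof.
move=> hip' [_ LdL _] Jt Dx e e0.
have d0 : 0 < e / (ip_norm ip x + 1) by rewrite divr_gt0 // ltr_wpDl ?nrm_ge0.
rewrite near_withinE /dnbhs near_withinE.
have := LdL t Jt _ d0; rewrite near_withinE; apply: filterS => s Ps st Js.
have {Ps} := Ps Js x Dx.
have st0 : s - t != 0 by rewrite subr_eq0.
have -> : L s x - L t x - (s - t)%:C *: dL t x = (s - t)%:C *:
    (((s - t)^-1)%:C *: (L s x - L t x) - dL t x).
  by rewrite scalerBr scalerA -rmorphM divff // scale1r.
rewrite (nrmZ hip') normcR mulrAC mulrC ler_pM2r ?normr_gt0 // => /le_trans;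
  apply.
rewrite mulrAC ler_pdivrMr ?ltr_wpDl ?nrm_ge0 // ler_pM2l // lerDl //.
Qed.

(** Uniformity in [x] matters: the bound is applied to solutions [w s] that move with the
    parameter. *)
Lemma C1_near (E E' : lmodType C) (D : set E) (ip : E -> E -> C)
    (ip' : E' -> E' -> C) (J : set R) L dL (t e : R) :
  semi_inner_product ip' -> C1_on D ip ip' J L dL -> J t -> 0 < e ->
  \forall s \near within J (nbhs t), opnorm_le D ip ip' (fun x => L s x - L t
    x) e.
Proof.
move=> hip' [Lb LdL _] Jt e0.
have [_ /bounded_ge0[c c0 hc]] := Lb t Jt.
have c1 : 0 < 1 + c by rewrite ltr_wpDr.
have : \forall s \near within J (nbhs t), `|s - t| <= e / (1 + c).
  rewrite near_withinE; apply/nbhs_ballP; exists (e / (1 + c));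
    first exact: divr_gt0.
  by move=> s /=; rewrite -ball_normE /ball_ /= distrC => /ltW.
apply: filterS2 (LdL t Jt 1 ltr01) => s Ls st x Dx.
rewrite -(subrK ((s - t)%:C *: dL t x) (L s x - L t x)).
apply: le_trans (nrmD hip' _ _) _; rewrite (nrmZ hip') normcR.
apply: le_trans (lerD (Ls x Dx) (ler_wpM2l (normr_ge0 _) (hc x Dx))) _.
rewrite mulrA -mulrDl ler_wpM2r ?nrm_ge0 //.
by rewrite [X in _ + X]mulrC -mulrDl mulrC -ler_pdivlMr.
Qed.

Lemma within_mono (I J : set R) (F : set_system R) {FF : Filter F} : I `<=` J ->
  within I F `=>` within J F.
Proof.
move=> IJ P hP; apply: (@filterS _ F _ _ (fun s => I s -> P s) _ hP).
by move=> s Ps /IJ.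
Qed.

Lemma within_punctured (J : set R) (t : R) :
  within J t^' `=>` within J (nbhs t).
Proof.
move=> P hP.
by apply: (@filterS _ (nbhs t) _ _ (fun s => s != t -> J s -> P s) _ hP) => s
  Ps _.
Qed.

Lemma sub_converges (F F' : set_system R) (E : lmodType C) (ip : E -> E -> C) f
  a :
  F `=>` F' -> converges F' ip f a -> converges F ip f a.
Proof. by move=> FF' fa e e0; exact/FF'/fa. Qed.

Lemma C1_converges (E E' : lmodType C) (D : set E) (ip : E -> E -> C)
    (ip' : E' -> E' -> C) (J : set R) L dL (t : R) x :
  semi_inner_product ip' -> C1_on D ip ip' J L dL -> J t -> D x ->
  converges (within J t^') ip' (fun s => L s x) (L t x).
Proof.
move=> hip' hL Jt Dx e e0; apply: within_punctured.
have d0 : 0 < e / (ip_norm ip x + 1) by rewrite divr_gt0 // ltr_wpDl ?nrm_ge0.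
apply: filterS (C1_near hip' hL Jt d0) => s /(_ x Dx)/le_trans; apply.
by rewrite mulrAC ler_pdivrMr ?ltr_wpDl ?nrm_ge0 // ler_pM2l // lerDl.
Qed.

(* [w t] solves an equation whose data are close to those of [u]; the a priori
   bound turns this into [w t -> u], the unknown norm of [w t] being absorbed in
   the left-hand side. *)
Lemma absorb_converges (F : set_system R) {FF : Filter F} (E : lmodType C)
    (ip : E -> E -> C) (w : R -> E) u (K : R) :
  semi_inner_product ip -> 0 <= K ->
  (forall e : R, 0 < e -> e <= 1 ->
     \forall s \near F, ip_norm ip (w s - u) <= K * e * (ip_norm ip (w s) + 1))
       ->
  converges F ip w u.
Proof.
move=> hip K0 h e e0; pose n := ip_norm ip u + 1.
have n0 : 0 < n by rewrite ltr_wpDl ?nrm_ge0.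
(* The bound 1 admits [d] in the hypothesis, the second makes [K d |w s - u|] at most half of
   [|w s - u|], and the third makes the remaining [K d n] at most [e / 2]. *)
pose d := Num.min 1 (Num.min (2^-1 / (K + 1)) (e / (2 * ((K + 1) * n)))).
have K1 : 0 < K + 1 by rewrite ltr_wpDl.
have d0 : 0 < d.
  by rewrite !lt_min ltr01 !divr_gt0 // ?mulr_gt0 // invr_gt0.
have := h d d0; rewrite ge_min lexx => /(_ isT); apply: filterS => s hs.
have d1 : d <= 2^-1 / (K + 1) by rewrite !ge_min lexx orbT.
have d2 : d <= e / (2 * ((K + 1) * n)) by rewrite !ge_min lexx !orbT.
move: d1 d2; rewrite ler_pdivlMr // ler_pdivlMr ?mulr_gt0 // => d1 d2.
have wn : ip_norm ip (w s) + 1 <= ip_norm ip (w s - u) + n.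
  by have := nrmD hip (w s - u) u; rewrite subrK /n; lra.
have x0 := nrm_ge0 ip (w s - u); move: hs wn x0.
move: (ip_norm ip (w s - u)) (ip_norm ip (w s)) => x y hs wn x0.
have Kd0 : 0 <= K * d by rewrite mulr_ge0 // ltW.
have h1 : x <= K * d * (x + n) by apply: le_trans hs _; rewrite ler_wpM2l.
have h2 : K * d * x <= 2^-1 * x by apply: ler_wpM2r => //; lra.
have h3 : 2 * (K * d * n) <= e.
  apply: le_trans d2; have : 0 <= d * n by rewrite mulr_ge0 // ltW.
  lra.
move: h1; rewrite mulrDr; lra.
Qed.

End NormConvergence.

(** * The crossing form *)

Section CrossingForm.
Set Implicit Arguments.
Unset Strict Implicit.
Import ComplexField.Normc.
Context {R : realType}.
Notation C := R[i].

Lemma centered_interval_center (t r : R) : 0 <= t <= 1 -> 0 < r ->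
  centered_interval t r t.
Proof. by move=> ht r0; split=> //; rewrite subrr normr0. Qed.

Lemma punctured_centered_proper (t r : R) : 0 <= t <= 1 -> 0 < r ->
  ProperFilter (within (centered_interval t r) t^').
Proof.
move=> /andP[t0 t1] r0; apply: Build_ProperFilter_ex => P.
move=> /nbhs_ballP[d /= d0 hd].
pose e := Num.min (d / 2) (Num.min (r / 2) 2^-1).
have e0 : 0 < e by rewrite !lt_min !divr_gt0 ?invr_gt0 // ltr0n.
have ed : e < d by apply: le_lt_trans (_ : d / 2 < d);
  [rewrite ge_min lexx|lra].
have er : e < r.
  by apply: le_lt_trans (_ : r / 2 < r); [rewrite !ge_min lexx orbT|lra].
have e2 : e <= 2^-1 by rewrite !ge_min lexx !orbT.
have [s [s01 st ste]] : exists s, [/\ 0 <= s <= 1, s != t & `|s - t| = e].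
  (* Stepping right from the left half of [0,1], and left otherwise, stays in [0,1] since
     [e <= 1/2]; this includes both endpoints. *)
  have [t2|t2] := leP t 2^-1; [exists (t + e)|exists (t - e)].
    split; first by apply/andP; split; lra.
      by apply/eqP; lra.
    by rewrite addrAC subrr add0r gtr0_norm.
  split; first by apply/andP; split; lra.
    by apply/eqP; lra.
  by rewrite addrAC subrr add0r normrN gtr0_norm.
exists s; apply: hd => //; first by rewrite -ball_normE /ball_ /= distrC ste.
by split=> //; rewrite ste.
Qed.

Variables (H : completeNormedModType C) (ipH : {dot H for Num.conj}).
Hypothesis hipH : induces_norm ipH.
Variables (G : completeNormedModType C) (ipG : {dot G for Num.conj}).
Let hH := dot_semi_inner ipH.
Let hG := dot_semi_inner ipG.
Let hG2 : semi_inner_product (ip2 ipG) := ip_sum_semi_inner hG hG.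
Variable A : operator H.
Hypothesis Adense : densely_defined A.
Local Notation As := (adjoint ipH A).

Variables (l t0 : R) (J : set R).
Variables (T dT : R -> H -> G * G) (V dV : R -> H -> H) (Q dQ : R -> G * G -> G
  * G).
Hypotheses (Jt0 : J t0)
  (hT : forall t, J t -> boundary_triplet ipH ipG A (T t))
  (hV : forall t, J t -> bounded_self_adjoint ipH (V t))
  (hQ : forall t, J t ->
     orthogonal_projection ipG (Q t) /\ lagrangian ipG (range (Q t)))
  (hdT : trace_C1 ipH ipG A J T dT) (hdV : C1_on setT ipH ipH J V dV)
  (hdQ : C1_on setT (ip2 ipG) (ip2 ipG) J Q dQ).
Local Notation D t := (op_shift (op_add As (V t)) l%:C).

Lemma shift_increment s t x : D s x - D t x = V s x - V t x.
Proof. by rewrite /= opprB addrA subrK opprD addrACA subrr add0r. Qed.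

(** The a priori bound is used only at [t0], on [w s - u]: its image under [D t0] is an increment of
    [V], and its trace is [a s] minus an increment of [T], both evaluated at [w s]. The equation for
    [w s] bounds its graph norm by its norm, so [absorb_converges] applies. *)
Lemma trace_lift_converges (F : set_system R) {FF : Filter F} (K : R)
    (w : R -> H) (a : R -> G * G) (u : H) :
  (forall P : set R, (\forall s \near within J (nbhs t0), P s) ->
     \forall s \near F, P s) ->
  0 <= K ->
  (forall z, dom As z ->
     ip_norm ipH z <= K * (ip_norm ipH (D t0 z) + ip_norm (ip2 ipG) (T t0 z)))
       ->
  ker_adj ipH A (V t0) l%:C u ->
  (\forall s \near F, [/\ J s, ker_adj ipH A (V s) l%:C (w s)
     & T s (w s) = T t0 u + a s]) ->
  converges F (ip2 ipG) a 0 -> converges F ipH w u.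
Proof.
move=> FJ K0 hK [Asu Du] hw ha.
have [Ad Al] := adjoint_linear hipH Adense.
have [c c0 hc] := bounded_ge0 (hV Jt0).1.
have [[Tl _] _ _] := hT Jt0.
(* [g |w s|] bounds the graph norm of [w s]; the last 1 absorbs the increment of [V], as
   [e <= 1]. *)
pose g := 1 + (`|l| + (c + 1)).
have g0 : 0 <= g by rewrite !addr_ge0.
apply: (@absorb_converges _ F _ _ ipH w u (K * (2 + g))) => //.
  by rewrite mulr_ge0 ?addr_ge0.
move=> e e0 e1.
have hT' := FJ _ (C1_near hG2 hdT Jt0 e0).
have hV' := FJ _ (C1_near hH hdV Jt0 e0).
apply: filterS2 hw (filterI (ha e e0) (filterI hT' hV')).
move=> s [Js [Asw Dw] Tw] [has [Ts Vs]].
have zD : dom As (w s - u) by exact: subspaceB.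
set W := ip_norm ipH (w s); have W0 : 0 <= W by exact: nrm_ge0.
have nV : ip_norm ipH (V s (w s) - V t0 (w s)) <= e * W by exact: Vs.
have nAs : ip_norm ipH (As (w s)) <= (`|l| + (c + 1)) * W.
  have -> : As (w s) = l%:C *: w s - (V t0 (w s) + (V s (w s) - V t0 (w s))).
    move/eqP: Dw; rewrite [D s _]/= subr_eq add0r => /eqP <-.
    by rewrite [V t0 _ + _]addrC subrK addrK.
  apply: le_trans (nrmB hH _ _) _; rewrite mulrDl; apply: lerD.
    by rewrite (nrmZ hH) normcR.
  apply: le_trans (nrmD hH _ _) _; rewrite mulrDl; apply: lerD; first exact: hc.
  by apply: le_trans nV _; rewrite ler_wpM2r.
have nT : ip_norm (ip2 ipG) (T s (w s) - T t0 (w s)) <= e * (g * W).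
  apply: le_trans (Ts _ Asw) _; rewrite ler_pM2l //.
  by apply: le_trans (nrm_graph_le _ _ _) _; rewrite mulrDl mul1r lerD2l.
apply: le_trans (hK _ zD) _; rewrite -mulrA -mulrA ler_wpM2l //.
have -> : D t0 (w s - u) = - (V s (w s) - V t0 (w s)).
  have [_ Dl] := shifted_linear l (hV Jt0) (adjoint_linear hipH Adense).
  rewrite (linear_onB Ad Dl) // [D t0 u]Du subr0 -[LHS]subr0 -Dw.
  by rewrite shift_increment opprB.
have -> : T t0 (w s - u) = a s - (T s (w s) - T t0 (w s)).
  by rewrite (linear_onB Ad Tl) // Tw opprB opprD [RHS]addrC !addrA subrK.
rewrite (nrmN hH); have := nrmB hG2 (a s) (T s (w s) - T t0 (w s)).
have := has; rewrite subr0 => has'.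
have -> : (2 + g) * (e * (W + 1)) =
    e * W + (e + e * (g * W)) + (e * W + e + e * g) by ring.
have := mulr_ge0 (ltW e0) W0; have := mulr_ge0 (ltW e0) g0.
move: nV nT; lra.
Qed.

Lemma omegaBl f g h : omega ipG (f - g) h = omega ipG f h - omega ipG g h.
Proof. by rewrite !omegaE /= !(ipBl hG); ring. Qed.

Lemma omegaDr f g h : omega ipG f (g + h) = omega ipG f g + omega ipG f h.
Proof. by rewrite !omegaE /= !(ipDr hG); ring. Qed.

Lemma omegaZl a f g : omega ipG (a *: f) g = a * omega ipG f g.
Proof. by rewrite !omegaE /= !(ipZl hG); ring. Qed.

Lemma omegaZr a f g : omega ipG f (a *: g) = conjc a * omega ipG f g.
Proof. by rewrite !omegaE /= !(ipZr hG); ring. Qed.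

(* Green's identity at [t0] turns the first component into the increment of
   [V], and the Lagrangian property of [ran (Q t)] the second one into the
   increment of [Q]. *)
Lemma crossing_identity t u w (a b : G * G) : J t ->
  ker_adj ipH A (V t0) l%:C u -> range (Q t0) (T t0 u) ->
  ker_adj ipH A (V t) l%:C w -> T t w = T t0 u + a ->
  range (Q t) (T t0 u + b) ->
  omega_hat ipG (T t0 u, T t0 u) (a, b) =
  ipH (V t u - V t0 u) w
  - omega ipG (T t u - T t0 u) (T t0 u + a)
  + omega ipG (Q t (T t0 u) - Q t0 (T t0 u)) (T t0 u + b).
Proof.
move=> Jt [Asu Du] [f0 _ Qf] [Asw Dw] Tw Qb.
have ff : omega ipG (T t0 u) (T t0 u) = 0.
  by rewrite -(triplet_green l (hT Jt0) (hV Jt0)) // [D t0 u]Du (ip0l hH) (ip0r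
    hH) subrr.
(* Green's identity with the data at [t]: [D t w = 0], while [D t u] is the increment of [V] at [u]
   because [D t0 u = 0]. *)
have Tuw : omega ipG (T t u) (T t0 u + a) = ipH (V t u - V t0 u) w.
  rewrite -Tw -(triplet_green l (hT Jt) (hV Jt)) // [D t w]Dw (ip0r hH) subr0.
  by rewrite -shift_increment [D t0 u]Du subr0.
have [[_ Qidem _] [_ Qlag]] := hQ Jt.
(* Both arguments lie in the Lagrangian subspace [ran (Q t)]. *)
have QQ : omega ipG (Q t (T t0 u)) (T t0 u + b) = 0.
  have : range (Q t) (Q t (T t0 u)) by exists (T t0 u).
  by rewrite {1}Qlag; exact.
have [[_ Qidem0 _] _] := hQ Jt0.
have Qf' : Q t0 (T t0 u) = T t0 u by rewrite -Qf Qidem0.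
by rewrite !omegaBl Tuw QQ Qf' /omega_hat /= !omegaDr ff; ring.
Qed.

Lemma self_crossing t u : J t -> ker_adj ipH A (V t0) l%:C u ->
  omega ipG (T t u) (T t u) = 0.
Proof.
move=> Jt [Asu Du].
rewrite -(triplet_green l (hT Jt) (hV Jt)) // -[D t u]subr0 -Du shift_increment.
have [_ Vt] := hV Jt; have [_ V0] := hV Jt0.
by rewrite (ipBl hH) (ipBr hH) Vt V0 subrr.
Qed.

(** This differentiates [omega (T t u, T t u) = 0], which [self_crossing] gives on all of [J]. It
    converts the boundary term of [crossing_identity] into the one of the Hadamard-type formula. *)
Lemma trace_derivative_symmetric (F : set_system R) {FF : ProperFilter F} u :
  F `=>` within J t0^' -> ker_adj ipH A (V t0) l%:C u ->
  omega ipG (dT t0 u) (T t0 u) = - omega ipG (T t0 u) (dT t0 u).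
Proof.
move=> FJ ku; have Asu : dom As u by case: ku.
have dq := sub_converges FJ (C1_difference_quotient hG2 hdT Jt0 Asu).
have Tc := sub_converges FJ (C1_converges hG2 hdT Jt0 Asu).
have T0c : converges F (ip2 ipG) (fun=> T t0 u) (T t0 u).
  exact: converges_cst.
(* A discrete Leibniz rule, exact for every [s] before passing to the limit. *)
have h0 s : J s -> omega ipG (((s - t0)^-1)%:C *: (T s u - T t0 u)) (T s u) +
    omega ipG (T t0 u) (((s - t0)^-1)%:C *: (T s u - T t0 u)) = 0.
  move=> Js; rewrite omegaZl omegaZr conjc_real -mulrDr omegaBl (self_crossing
    Js ku).
  have := omegaDr (T t0 u) (T s u - T t0 u) (T t0 u).
  by rewrite subrK (self_crossing Jt0 ku) => ->; ring.
have h : (0 : C^o) @[_ --> F] -->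
    (omega ipG (dT t0 u) (T t0 u) + omega ipG (T t0 u) (dT t0 u) : C^o).
  apply: cvg_trans (cvgD (converges_omega hG dq Tc) (converges_omega hG T0c
    dq)).
  by apply: near_eq_cvg; apply: FJ; apply: filterS (withinT J _) => s;
    exact: h0.
apply/eqP; rewrite -addr_eq0; apply/eqP.
exact: (cvg_unique (@norm_hausdorff _ C^o) h (cvg_cst _)).
Qed.

Lemma crossing_derivative (I : set R) M u (K : R) :
  ProperFilter (within I t0^') -> I `<=` J -> I t0 -> 0 <= K ->
  (forall z, dom As z ->
     ip_norm ipH z <= K * (ip_norm ipH (D t0 z) + ip_norm (ip2 ipG) (T t0 z)))
       ->
  graph_family ipG I t0 (fun t => upsilon ipH A (T t) (V t) (Q t) l%:C) M ->
  ker_adj ipH A (V t0) l%:C u -> range (Q t0) (T t0 u) ->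
  is_derive_within I
    (fun t => omega_hat ipG (T t0 u, T t0 u) (M t (T t0 u, T t0 u))) t0
    (ipH (dV t0 u) u + omega ipG (dQ t0 (T t0 u)) (T t0 u)
     + omega ipG (T t0 u) (dT t0 u)).
Proof.
move=> FF IJ It0 K0 hK [[dM hM] _ M0 hUps] ku Qu.
pose f := T t0 u; pose q := (f, f); rewrite -/f -/q.
have Asu : dom As u by case: ku.
have FJ' : within I (nbhs t0) `=>` within J (nbhs t0) by exact: within_mono.
have FJ : within I t0^' `=>` within J t0^' by exact: within_mono.
have Uq : upsilon ipH A (T t0) (V t0) (Q t0) l%:C q by split=> //; exists u.
have hG4 : semi_inner_product (ip4 ipG) := ip_sum_semi_inner hG2 hG2.
have Mc := C1_converges hG4 hM It0 Uq; rewrite M0 // in Mc.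
pose a t := (M t q).1; pose b t := (M t q).2.
have ac : converges (within I t0^') (ip2 ipG) a 0.
  move=> e e0; apply: filterS (Mc e e0) => s; apply: le_trans.
  exact: (nrm_fst_le (M s q - 0) hG2 hG2).
have bc : converges (within I t0^') (ip2 ipG) b 0.
  move=> e e0; apply: filterS (Mc e e0) => s; apply: le_trans.
  exact: (nrm_snd_le (M s q - 0) hG2 hG2).
(* For [t] in [I], [q + M t q] lies in [upsilon], so its first component is the trace of a solution
   [w t]; outside [I] the value 0 is a placeholder. *)
have /choice[w hw] : forall t, exists w, I t ->
    [/\ ker_adj ipH A (V t) l%:C w, T t w = f + a t & range (Q t) (f + b t)].
  move=> t; have [It|nIt] := pselect (I t); last by exists 0.
  have : upsilon ipH A (T t) (V t) (Q t) l%:C (q + M t q).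
    by rewrite hUps //; exists q.
  by move=> [/= [w kw Tw] Qb]; exists w.
have fc c : converges (within I t0^') (ip2 ipG) c 0 ->
    converges (within I t0^') (ip2 ipG) (fun s => f + c s) f.
  move=> hc e e0; apply: filterS (hc e e0) => s.
  by rewrite subr0 addrAC subrr add0r.
have wc : converges (within I t0^') ipH w u.
  apply: (trace_lift_converges _ K0 hK ku _ ac) => [P hP|].
    exact/within_punctured/FJ'.
  apply: filterS (withinT I _) => s Is; have [kw Tw _] := hw s Is.
  by split=> //; exact: IJ.
have dTq := sub_converges FJ (C1_difference_quotient hG2 hdT Jt0 Asu).
have dVq := sub_converges FJ (C1_difference_quotient hH hdV Jt0 (Logic.I : setT
  u)).
have dQq := sub_converges FJ (C1_difference_quotient hG2 hdQ Jt0 (Logic.I :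
  setT f)).
have -> : ipH (dV t0 u) u + omega ipG (dQ t0 f) f + omega ipG f (dT t0 u) =
    ipH (dV t0 u) u - omega ipG (dT t0 u) f + omega ipG (dQ t0 f) f.
  rewrite (trace_derivative_symmetric FJ ku) opprK; ring.
apply: cvg_trans (cvgD (cvgB (converges_ip hH dVq wc)
  (converges_omega hG dTq (fc _ ac))) (converges_omega hG dQq (fc _ bc))).
apply: near_eq_cvg.
apply: filterS (withinT I _) => s Is /=; have [kw Tw Qb] := hw s Is.
rewrite /diff_quotient M0 // -[M s q]/(M s q).
have -> : omega_hat ipG q 0 = 0.
  by rewrite /omega_hat !omegaE /= !(ip0r hG); ring.
rewrite subr0 [M s q]surjective_pairing.
rewrite (crossing_identity (IJ s Is) ku Qu kw Tw Qb).
rewrite !fctE (ipZl hH) !omegaZl; ring.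
Qed.

End CrossingForm.

(** * Eigenvalue derivatives as values of the crossing form *)

Theorem theorem4p20 (R : realType)
  (H : completeNormedModType R[i]) (ipH : {dot H for Num.conj})
  (hipH : induces_norm ipH) (hsepH : separable_space H)
  (G : completeNormedModType R[i]) (ipG : {dot G for Num.conj})
  (hipG : induces_norm ipG) (hsepG : separable_space G)
  (A : operator H)
  (hAlin : linear_op A) (hAdense : densely_defined A) (hAclosed : closed_op A)
  (hAsym : symmetric_op ipH A) (hAdef : equal_deficiency_indices ipH A)
  (T : R -> H -> G * G) (Q : R -> G * G -> G * G)
  (cA : R -> operator H) (V : R -> H -> H)
  (hT : forall t : R, 0 <= t <= 1 -> boundary_triplet ipH ipG A (T t))
  (hQ : forall t : R, 0 <= t <= 1 ->
     orthogonal_projection ipG (Q t) /\ lagrangian ipG (range (Q t)))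
  (hcA : forall t : R, 0 <= t <= 1 ->
     [/\ self_adjoint ipH (cA t), extends A (cA t)
       & T t @` dom (cA t) = range (Q t)])
  (hV : forall t : R, 0 <= t <= 1 -> bounded_self_adjoint ipH (V t))
  (Ht : R -> operator H) (hHt : forall t : R, Ht t = op_add (cA t) (V t))
  (l0 t0 : R) (ht0 : 0 <= t0 <= 1)
  (hconj : ker_op (op_shift (Ht t0) l0%:C) <> [set 0])
  (hess : ~ ess_spectrum ipH (Ht t0) l0%:C)
  (r : R) (hr : 0 < r) (J : set R) (hJ : J = centered_interval t0 r)
  (dT : R -> H -> G * G) (hdT : trace_C1 ipH ipG A J T dT)
  (dV : R -> H -> H) (hdV : C1_on setT ipH ipH J V dV)
  (dQ : R -> G * G -> G * G) (hdQ : C1_on setT (ip2 ipG) (ip2 ipG) J Q dQ)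
  (hker : forall t, J t -> ker_adj ipH A (V t) l0%:C `&` dom A = [set 0])
  (m : nat) (hm : has_dim (ker_op (op_shift (Ht t0) l0%:C)) m)
  (u : 'I_m -> H)
  (hu : fin_orthonormal_basis ipH (ker_op (op_shift (Ht t0) l0%:C)) u)
  (lam : 'I_m -> R -> R)
  (hlam : bifurcating_eigenvalues ipH J Ht t0 l0 lam)
  (hdlam : forall j, is_derive_within J (fun t => (lam j t)%:C) t0
     (ipH (dV t0 (u j)) (u j)
      + omega ipG (dQ t0 (T t0 (u j))) (T t0 (u j))
      + omega ipG (T t0 (u j)) (dT t0 (u j))))
  (Ups : R -> set ((G * G) * (G * G)))
  (hUps : forall t, Ups t = upsilon ipH A (T t) (V t) (Q t) l0%:C)
  (r' : R) (hr' : 0 < r') (I : set R) (hI : I = centered_interval t0 r')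
  (hIJ : I `<=` J)
  (M : R -> (G * G) * (G * G) -> (G * G) * (G * G))
  (hM : graph_family ipG I t0 Ups M)
  (q : 'I_m -> (G * G) * (G * G))
  (hq : forall j, q j = (T t0 (u j), T t0 (u j))) :
  forall j,
    (Ups t0 `&` diagonal) (q j) /\
    derive_within J (fun t => (lam j t)%:C) t0 =
      maslov_crossing_form ipG I t0 M (q j) (q j).
Proof.
move=> j.
have It0 : I t0 by rewrite hI; exact: centered_interval_center.
have Jt0 : J t0 := hIJ t0 It0.
have J01 t : J t -> 0 <= t <= 1 by rewrite hJ => -[].
have [cAsa AcA cATQ] := hcA t0 ht0.
have [uker _ _] := hu.
have [cAu Hu] := uker j; rewrite hHt in cAu Hu.
have [Asu AsuE] := extension_adjoint hipH hAdense cAsa AcA cAu.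
have ku : ker_adj ipH A (V t0) l0%:C (u j).
  split=> //; rewrite -[RHS]Hu.
  exact: (congr1 (fun y => y + V t0 (u j) - l0%:C *: u j) AsuE).
have Qu : range (Q t0) (T t0 (u j)) by rewrite -cATQ; exists (u j).
have UpsE : Ups = fun t => upsilon ipH A (T t) (V t) (Q t) l0%:C.
  by apply/funext => t; exact: hUps.
split; first by rewrite hq UpsE; split=> //; split=> //; exists (u j).
(* The disc isolating the bifurcating eigenvalues supplies the spectral gap around [l0] needed for
   surjectivity. *)
have [_ [e [e0 hspec _]]] := hlam.
rewrite hHt in hspec; rewrite hHt in hu.
have [K K0 hK] := triplet_surjective hipH hAlin hAdense (hT t0 ht0) (hV t0 ht0)
  hipG hAclosed hAsym (hker t0 Jt0) cAsa AcA e0 hspec hu.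
have [K' K'0 hK'] := triplet_a_priori (hT t0 ht0) (hV t0 ht0) K0 hK.
have FI : ProperFilter (within I t0^').
  by rewrite hI; exact: punctured_centered_proper.
have FJ : ProperFilter (within J t0^').
  by rewrite hJ; exact: punctured_centered_proper.
rewrite UpsE in hM.
have hT' t : J t -> boundary_triplet ipH ipG A (T t) by move=> /J01; exact: hT.
have hV' t : J t -> bounded_self_adjoint ipH (V t) by move=> /J01; exact: hV.
have hQ' t : J t -> orthogonal_projection ipG (Q t) /\ lagrangian ipG (range (Q
  t)).
  by move=> /J01; exact: hQ.
have := crossing_derivative hipH hAdense Jt0 hT' hV' hQ' hdT hdV hdQ FI hIJ It0
  K'0 hK' hM ku Qu.
rewrite /maslov_crossing_form /derive_within hq => h.
(* Both difference quotients, one along [J] and one along [I], have the Hadamard-type expression as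
   limit. *)
rewrite (cvg_lim (@norm_hausdorff _ _) (hdlam j)).
by rewrite (cvg_lim (@norm_hausdorff _ _) h).
Qed.
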